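(* For each $s<t$ in $\mathbb R$ and each $\varphi\in L^2(\mathbb R^n,\nu_t)$, $$\|P_{s,t}(\varphi-M_t\varphi)\|_{L^2(\mathbb R^n,\nu_s)}\le e^{c_0(t-s)}\|\varphi\|_{L^2(\mathbb R^n,\nu_t)}.$$
   Context: Let $n\ge 1$ and let $A,B:\mathbb R\to\mathcal L(\mathbb R^n)$, $f:\mathbb R\to\mathbb R^n$ be continuous and bounded (not necessarily periodic), with $\|B(t)x\|\ge \mu_0\|x\|$ for all $t,x$ and some $\mu_0>0$. Let $U(t,s)$ be the evolution operator of $\xi'=A(t)\xi$, and assume $\omega_0(U):=\inf\{\omega:\exists M,\ \|U(t,s)\|\le Me^{\omega(t-s)}\ \forall s\le t\}<0$; for each $\omega\in(\omega_0(U),0)$ let $M(\omega)$ be a constant with $\|U(t,s)\|\le M(\omega)e^{\omega(t-s)}$ for all $s\le t$. Let $C:=\sup_{t}\|B(t)\|$ and $c_0:=\inf\{\omega\mu_0^2/(M(\omega)^2C^2):\ \omega\in(\omega_0(U),0)\}$. For $-\infty\le s<t$ let $Q(t,s)=\int_s^tU(t,r)B(r)B^*(r)U^*(t,r)dr$, $g(t,s)=\int_s^tU(t,r)f(r)dr$, $\nu_t=\mathcal N_{g(t,-\infty),Q(t,-\infty)}$ (Gaussian measure on $\mathbb R^n$). $P_{s,t}\varphi(x)=\int_{\mathbb R^n}\varphi(y)\,\mathcal N_{U(t,s)x+g(t,s),Q(t,s)}(dy)$, extended to a contraction $L^2(\mathbb R^n,\nu_t)\to L^2(\mathbb R^n,\nu_s)$.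 $M_t\varphi:=\int_{\mathbb R^n}\varphi\,d\nu_t$. *)

(* Defs.v *)
From HB Require Import structures.
From mathcomp Require Import all_boot all_order all_algebra.
From mathcomp Require Import all_classical all_reals all_analysis.
Set Implicit Arguments. Unset Strict Implicit. Unset Printing Implicit Defensive.
Import Order.TTheory GRing.Theory Num.Theory.
Import numFieldNormedType.Exports.
Local Open Scope classical_set_scope.
Local Open Scope ring_scope.

(* The space R^n is represented, as a measurable space, by [n.-tuple R] with
   its canonical product (= Borel) sigma-algebra; linear algebra is done on
   column vectors ['cV[R]_n], and the two are identified via [col_of]. *)

Section Defs.
Context {R : realType} {n : nat}.

Definition col_of (x : n.-tuple R) : 'cV[R]_n := \col_i tnth x i.

Definition dotp (u v : 'cV[R]_n) : R := \sum_i u i 0 * v i 0.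
Definition enorm (v : 'cV[R]_n) : R := Num.sqrt (dotp v v).

Definition opnorm (M : 'M[R]_n) : R :=
  sup [set enorm (M *m v) | v in [set v | enorm v <= 1]].

Definition growth_set (U : R -> R -> 'M[R]_n) : set R :=
  [set w | exists K : R, forall s t, s <= t ->
      opnorm (U t s) <= K * expR (w * (t - s))].
Definition growth_bound (U : R -> R -> 'M[R]_n) : R := inf (growth_set U).

Definition mint (D : set R) (F : R -> 'M[R]_n) : 'M[R]_n :=
  \matrix_(i, j) (\int[lebesgue_measure]_(r in D) F r i j).
Definition vint (D : set R) (F : R -> 'cV[R]_n) : 'cV[R]_n :=
  \col_i (\int[lebesgue_measure]_(r in D) F r i 0).

Definition Qmat (U : R -> R -> 'M[R]_n) (B : R -> 'M[R]_n) (t s : R) : 'M[R]_n :=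
  mint `[s, t] (fun r => U t r *m B r *m (B r)^T *m (U t r)^T).
Definition Qinf (U : R -> R -> 'M[R]_n) (B : R -> 'M[R]_n) (t : R) : 'M[R]_n :=
  mint `]-oo, t] (fun r => U t r *m B r *m (B r)^T *m (U t r)^T).

Definition gvec (U : R -> R -> 'M[R]_n) (f : R -> 'cV[R]_n) (t s : R) : 'cV[R]_n :=
  vint `[s, t] (fun r => U t r *m f r).
Definition ginf (U : R -> R -> 'M[R]_n) (f : R -> 'cV[R]_n) (t : R) : 'cV[R]_n :=
  vint `]-oo, t] (fun r => U t r *m f r).

(* mu is the Gaussian measure N_{a,Q}: its Fourier transform (characteristic
   function) is  xi |-> exp(i <xi,a> - <Q xi, xi>/2), written via its real
   and imaginary parts. *)
Definition is_gaussian (mu : probability (n.-tuple R) R) (a : 'cV[R]_n)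
    (Q : 'M[R]_n) : Prop :=
  forall xi : 'cV[R]_n,
    (\int[mu]_x (cos (dotp xi (col_of x)))%:E
       = (cos (dotp xi a) * expR (- (dotp (Q *m xi) xi) / 2))%:E)%E /\
    (\int[mu]_x (sin (dotp xi (col_of x)))%:E
       = (sin (dotp xi a) * expR (- (dotp (Q *m xi) xi) / 2))%:E)%E.

Definition covariance_matrix (Q : 'M[R]_n) : Prop :=
  Q^T = Q /\ forall v : 'cV[R]_n, 0 <= dotp (Q *m v) v.

Definition nu (N : 'cV[R]_n -> 'M[R]_n -> probability (n.-tuple R) R)
    (U : R -> R -> 'M[R]_n) (B : R -> 'M[R]_n) (f : R -> 'cV[R]_n) (t : R)
    : probability (n.-tuple R) R :=
  N (ginf U f t) (Qinf U B t).

Definition Pst (N : 'cV[R]_n -> 'M[R]_n -> probability (n.-tuple R) R)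
    (U : R -> R -> 'M[R]_n) (B : R -> 'M[R]_n) (f : R -> 'cV[R]_n) (s t : R)
    (phi : n.-tuple R -> R) (x : n.-tuple R) : R :=
  \int[N (U t s *m col_of x + gvec U f t s) (Qmat U B t s)]_(y in setT) phi y.

Definition Mt (N : 'cV[R]_n -> 'M[R]_n -> probability (n.-tuple R) R)
    (U : R -> R -> 'M[R]_n) (B : R -> 'M[R]_n) (f : R -> 'cV[R]_n) (t : R)
    (phi : n.-tuple R -> R) : R :=
  \int[nu N U B f t]_(y in setT) phi y.

Definition c0 (U : R -> R -> 'M[R]_n) (B : R -> 'M[R]_n) (mu0 : R)
    (Mw : R -> R) : R :=
  let C := sup (range (fun t => opnorm (B t))) in
  inf [set w * mu0 ^+ 2 / (Mw w ^+ 2 * C ^+ 2) | w in `]growth_bound U, 0[].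

End Defs.

(* Main.v *)
Require Import Defs.
From HB Require Import structures.
From mathcomp Require Import all_boot all_order all_algebra.
From mathcomp Require Import all_classical all_reals all_analysis.
From mathcomp Require Import measurable_realfun ring lra.
Set Implicit Arguments. Unset Strict Implicit. Unset Printing Implicit Defensive.
Import Order.TTheory GRing.Theory Num.Theory.
Import numFieldNormedType.Exports.
Local Open Scope classical_set_scope.
Local Open Scope ring_scope.

(** The pair (X, Y) with X ~ nu_s and Y | X = x distributed as the transition
    kernel of P_{s,t} at x is jointly Gaussian, so the operator norm of P_{s,t}
    on centred functions is its maximal canonical correlation: it is at most
    sqrt rho as soon as S := U(t,s) Q_s U(t,s)^* <= rho Q_t, Q_r denoting
    Q(r,-oo).

    This is read off characteristic functions. For a trigonometric polynomial
    the variances of phi under nu_t and of P_{s,t} phi under nu_s are the same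
    quadratic form, built from cosh - 1 and sinh, evaluated on the kernels
    <Q_t xi, xi'> and <S xi, xi'>. Both functions have power series with
    nonnegative coefficients and no constant term, so the Schur product theorem
    yields the comparison. Trigonometric polynomials generate all bounded
    measurable functions by bounded pointwise limits, which gives the
    measurability of the kernel, the identity nu_s P_{s,t} = nu_t and density in
    L^2(nu_t); truncation and Fatou's lemma do the rest.

    Finally S <= rho Q_t with rho = exp (2 c_0 (t - s)) follows from Gronwall's
    lemma for s |-> <S xi, xi>. *)

(** * Positive semidefinite kernels *)

(** The measures [N a Q] are known only through their Fourier transforms, and nothing is assumed
    about how they depend on [a]; this is why every step is tested on trigonometric polynomials.
    Centring is what removes the constant term of the power series: that term is the squared mean,
    on which [P_{s,t}] does not contract. The same factor [rho] serves for every degree because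
    [Q_t - S = Q(t,s)] is itself positive semidefinite. The constant [c_0] arises as follows. Freeze
    [t] and put [q(x) = <U(t,x) Q_x U(t,x)^* xi, xi>]. Then [q' = |B^* U(t,x)^* xi|^2 >= mu_0^2
    |U(t,x)^* xi|^2], whereas the decay at rate [w] gives [q <= (C M)^2 / (-2 w) |U(t,x)^* xi|^2].
    The quotient of the two constants is [-2 w mu_0^2 / (M^2 C^2)]. Each admissible [w] gives its
    own bound between the same two numbers [q(s)] and [q(t)], so the infimum over [w] may be
    taken. *)

Section PsdKernels.
Context {R : realType}.

Definition psd_kernel (X : Type) (k : X -> X -> R) : Prop :=
  forall s : seq (R * X),
    0 <= \sum_(p <- s) \sum_(q <- s) p.1 * q.1 * k p.2 q.2.

Lemma psd_kernelD (X : Type) (k l : X -> X -> R) :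
  psd_kernel k -> psd_kernel l -> psd_kernel (fun x y => k x y + l x y).
Proof.
move=> hk hl s; have := addr_ge0 (hk s) (hl s).
rewrite -big_split /=; under eq_bigr do rewrite -big_split /=.
by under eq_bigr do under eq_bigr do rewrite -mulrDr.
Qed.

Lemma psd_kernelZ (X : Type) (a : R) (k : X -> X -> R) :
  0 <= a -> psd_kernel k -> psd_kernel (fun x y => a * k x y).
Proof.
move=> a0 hk s; have := mulr_ge0 a0 (hk s).
rewrite mulr_sumr; under eq_bigr do rewrite mulr_sumr.
by under eq_bigr do under eq_bigr do rewrite mulrCA.
Qed.

Lemma psd_kernel0 (X : Type) : @psd_kernel X (fun _ _ => 0).
Proof. by move=> s; rewrite big1// => p _; rewrite big1// => q _; rewrite mulr0. Qed.

Lemma psd_kernel1 (X : Type) : @psd_kernel X (fun _ _ => 1).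
Proof.
move=> s; under eq_bigr do under eq_bigr do rewrite mulr1.
under eq_bigr do rewrite -mulr_sumr.
by rewrite -mulr_suml -expr2 sqr_ge0.
Qed.

Lemma psd_kernel_sum (X : Type) (m : nat) (k : nat -> X -> X -> R) :
  (forall i, psd_kernel (k i)) ->
  psd_kernel (fun x y => \sum_(i < m) k i x y).
Proof.
move=> hk; elim: m => [|m IH].
  by under eq_fun do under eq_fun do rewrite big_ord0; exact: psd_kernel0.
under eq_fun do under eq_fun do rewrite big_ord_recr /=.
exact: (psd_kernelD IH (hk m)).
Qed.

Lemma cvg_sum_seq (I : Type) (r : seq I) (u : I -> nat -> R) (l : I -> R) :
  (forall i, u i @ \oo --> l i) ->
  (fun n => \sum_(i <- r) u i n) @ \oo --> \sum_(i <- r) l i.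
Proof.
move=> ul; elim: r => [|i r IH].
  rewrite big_nil; under eq_fun do rewrite big_nil; exact: cvg_cst.
rewrite big_cons; under eq_fun do rewrite big_cons; exact: cvgD.
Qed.

Lemma psd_kernel_cvg (X : Type) (u : nat -> X -> X -> R) (k : X -> X -> R) :
  (forall i, psd_kernel (u i)) ->
  (forall x y, (fun i => u i x y) @ \oo --> k x y) -> psd_kernel k.
Proof.
move=> hu uk s.
have cv : (fun i => \sum_(p <- s) \sum_(q <- s) p.1 * q.1 * u i p.2 q.2) @ \oo
    --> \sum_(p <- s) \sum_(q <- s) p.1 * q.1 * k p.2 q.2.
  by do 2 apply: cvg_sum_seq => ?; apply: cvgMl_tmp; exact: uk.
by apply: (ler_cvg_to (cvg_cst 0) cv); apply: nearW => i; exact: hu.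
Qed.

Lemma cvg_expR_sub1 (q : R) :
  (fun m => \sum_(i < m) q ^+ i.+1 / i.+1`!%:R) @ \oo --> expR q - 1.
Proof.
have h : (series (exp_coeff q) \o S) @ \oo --> expR q.
  by rewrite (cvg_shiftS (series _)); exact: is_cvg_series_exp_coeff.
rewrite (_ : (fun m => _) = (fun m => (series (exp_coeff q) \o S) m - 1)).
  by apply: cvgB => //; exact: cvg_cst.
apply/funext => m; rewrite /series /= big_nat_recl// big_mkord /exp_coeff /=.
by rewrite expr0 fact0 divr1 addrAC subrr add0r.
Qed.

(* [(e^q - 1 + sg (e^-q - 1)) / 2] is [cosh q - 1] for [sg = 1] and [sinh q]
   for [sg = -1]; both have a power series with nonnegative coefficients and
   no constant term. *)
Definition hyperb (sg q : R) : R :=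
  ((expR q - 1) + sg * (expR (- q) - 1)) / 2.

(** The factor [(1 + sg * (-1) ^+ i.+1) / 2] selects the even powers for [sg = 1] and the odd ones
    for [sg = -1]. *)
Lemma cvg_hyperb (sg q : R) :
  (fun m => \sum_(i < m) (1 + sg * (-1) ^+ i.+1) / 2 / i.+1`!%:R * q ^+ i.+1)
    @ \oo --> hyperb sg q.
Proof.
rewrite (_ : (fun m => _) = (fun m => (\sum_(i < m) q ^+ i.+1 / i.+1`!%:R +
    sg * \sum_(i < m) (- q) ^+ i.+1 / i.+1`!%:R) / 2)).
  apply: cvgMr_tmp; apply: cvgD; first exact: cvg_expR_sub1.
  by apply: cvgMl_tmp; exact: cvg_expR_sub1.
apply/funext => m; rewrite mulr_sumr -big_split /= mulr_suml.
apply: eq_bigr => i _; rewrite [in RHS]exprNn.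
by move: ((-1) ^+ _) (q ^+ _) (_`!%:R^-1) => a b c; ring.
Qed.

End PsdKernels.

Section EuclideanForms.
Context {R : realType} {n : nat}.
Implicit Types (Q S L : 'M[R]_n) (u v : 'cV[R]_n).

Lemma dotpC u v : dotp u v = dotp v u.
Proof. by apply: eq_bigr => i _; rewrite mulrC. Qed.

Lemma dotpDl u v w : dotp (u + v) w = dotp u w + dotp v w.
Proof. by rewrite -big_split; apply: eq_bigr => i _; rewrite !mxE mulrDl. Qed.

Lemma dotpZl a u w : dotp (a *: u) w = a * dotp u w.
Proof. by rewrite mulr_sumr; apply: eq_bigr => i _; rewrite !mxE mulrA. Qed.

Lemma dotpDr u v w : dotp w (u + v) = dotp w u + dotp w v.
Proof. by rewrite dotpC dotpDl !(dotpC w). Qed.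

Lemma dotpZr a u w : dotp w (a *: u) = a * dotp w u.
Proof. by rewrite dotpC dotpZl (dotpC w). Qed.

Lemma dotpNl u w : dotp (- u) w = - dotp u w.
Proof. by rewrite -scaleN1r dotpZl mulN1r. Qed.

Lemma dotpNr u w : dotp w (- u) = - dotp w u.
Proof. by rewrite dotpC dotpNl dotpC. Qed.

Lemma dotp0l u : dotp 0 u = 0.
Proof. by rewrite -(scale0r u) dotpZl mul0r. Qed.

Lemma dotp_ge0 u : 0 <= dotp u u.
Proof. by apply: sumr_ge0 => i _; rewrite -expr2 sqr_ge0. Qed.

Lemma dotp_eq0 u : dotp u u = 0 -> u = 0.
Proof.
move=> /eqP; rewrite psumr_eq0; last by move=> i _; rewrite -expr2 sqr_ge0.
move=> /allP h; apply/colP => i; rewrite mxE.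
by have := h i (mem_index_enum _); rewrite mulf_eq0 orbb => /eqP.
Qed.

Lemma dotp_tr (M : 'M[R]_n) u v : dotp (M *m u) v = dotp u (M^T *m v).
Proof.
rewrite /dotp; under eq_bigr do rewrite mxE mulr_suml.
rewrite exchange_big /=; apply: eq_bigr => i _; rewrite mxE mulr_sumr.
by apply: eq_bigr => j _; rewrite mxE mulrCA mulrA.
Qed.

Lemma dotp_sum_entries Q u v : dotp (Q *m u) v = \sum_i \sum_j Q i j * u j 0 * v i 0.
Proof. by apply: eq_bigr => i _; rewrite mxE mulr_suml. Qed.

(* By self-duality of the psd cone this is positive semidefiniteness; the dual
   form is the one that an integral of Gram matrices visibly satisfies, and it
   makes the Schur product theorem immediate. *)
Definition dual_psd Q : Prop :=
  forall L, (forall v, 0 <= dotp (L *m v) v) -> 0 <= \sum_i \sum_j L i j * Q i j.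

Lemma dual_psdD Q S : dual_psd Q -> dual_psd S -> dual_psd (Q + S).
Proof.
move=> hQ hS L hL; have := addr_ge0 (hQ L hL) (hS L hL).
rewrite -big_split /=; under eq_bigr do rewrite -big_split /=.
under eq_bigr do under eq_bigr do rewrite -mulrDr.
by under [X in _ -> _ <= X]eq_bigr do under eq_bigr do rewrite mxE.
Qed.

(** Schur product theorem. For fixed weights, the matrix [L] paired with [Q] is the sum in question,
    and [<L v, v>] is the sum for [k] with each weight [p.1] replaced by [p.1 * <p.2, v>]; hence [L]
    is an admissible test in [dual_psd Q]. *)
Lemma psd_kernelM_form Q (k : 'cV[R]_n -> 'cV[R]_n -> R) :
  dual_psd Q -> psd_kernel k -> psd_kernel (fun u v => dotp (Q *m u) v * k u v).
Proof.
move=> hQ hk s.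
pose L : 'M[R]_n := \matrix_(i, j)
  \sum_(p <- s) \sum_(q <- s) p.1 * q.1 * k p.2 q.2 * (p.2 j 0 * q.2 i 0).
have hL v : 0 <= dotp (L *m v) v.
  have := hk [seq (p.1 * dotp p.2 v, p.2) | p <- s].
  rewrite big_map; under eq_bigr do rewrite big_map /=.
  congr (_ <= _); rewrite dotp_sum_entries.
  under [RHS]eq_bigr => i _ do under eq_bigr => j _ do
    rewrite mxE !mulr_suml; under [RHS]eq_bigr => i _ do rewrite exchange_big /=.
  rewrite [RHS]exchange_big /=; apply: eq_bigr => p _.
  under [RHS]eq_bigr => i _ do under eq_bigr => j _ do rewrite !mulr_suml.
  under [RHS]eq_bigr => i _ do rewrite exchange_big /=.
  rewrite [RHS]exchange_big /=; apply: eq_bigr => q _.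
  rewrite {1}/dotp {1}/dotp.
  rewrite mulr_sumr mulr_sumr big_distrlr /= exchange_big /= mulr_suml.
  apply: eq_bigr => i _; rewrite mulr_suml.
  by apply: eq_bigr => j _; ring.
have := hQ L hL; congr (_ <= _).
under eq_bigr => i _ do under eq_bigr => j _ do
  rewrite mxE !mulr_suml; under eq_bigr => i _ do rewrite exchange_big /=.
rewrite exchange_big /=; apply: eq_bigr => p _.
under eq_bigr => i _ do under eq_bigr => j _ do rewrite !mulr_suml.
under eq_bigr => i _ do rewrite exchange_big /=.
rewrite exchange_big /=; apply: eq_bigr => q _.
rewrite dotp_sum_entries mulr_suml mulr_sumr; apply: eq_bigr => i _.
by rewrite mulr_suml mulr_sumr; apply: eq_bigr => j _; ring.
Qed.

Lemma psd_kernel_form_pow Q m :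
  dual_psd Q -> psd_kernel (fun u v => dotp (Q *m u) v ^+ m).
Proof.
move=> hQ; elim: m => [|m IH].
  by under eq_fun do under eq_fun do rewrite expr0; exact: psd_kernel1.
under eq_fun do under eq_fun do rewrite exprS.
exact: (psd_kernelM_form hQ IH).
Qed.

(** By bilinearity the double sum is the form at one vector. Positivity is assumed in its plain form
    because that is what [hrho] yields for [rho *: Q - S]. *)
Lemma psd_kernel_form Q : (forall v, 0 <= dotp (Q *m v) v) ->
  psd_kernel (fun u v => dotp (Q *m u) v).
Proof.
move=> hQ s; have := hQ (\sum_(p <- s) p.1 *: p.2).
suff -> : dotp (Q *m \sum_(p <- s) p.1 *: p.2) (\sum_(p <- s) p.1 *: p.2) =
  \sum_(p <- s) \sum_(q <- s) p.1 * q.1 * dotp (Q *m p.2) q.2 by [].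
have dsl (r : seq (R * 'cV[R]_n)) w :
    dotp (Q *m \sum_(p <- r) p.1 *: p.2) w = \sum_(p <- r) p.1 * dotp (Q *m p.2) w.
  elim: r => [|p r IH]; first by rewrite !big_nil mulmx0 dotp0l.
  by rewrite !big_cons mulmxDr dotpDl IH -scalemxAr dotpZl.
have dsr (r : seq (R * 'cV[R]_n)) w :
    dotp w (\sum_(p <- r) p.1 *: p.2) = \sum_(p <- r) p.1 * dotp w p.2.
  elim: r => [|p r IH]; first by rewrite !big_nil dotpC dotp0l.
  by rewrite !big_cons dotpDr IH dotpZr.
rewrite dsl; apply: eq_bigr => p _; rewrite dsr mulr_sumr.
by apply: eq_bigr => q _; rewrite mulrA.
Qed.

Section Comparison.
Variables (Q S : 'M[R]_n) (rho : R).
Hypotheses (hQ : dual_psd Q) (hS : dual_psd S) (hQS : dual_psd (Q - S)).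
Hypothesis hrho : forall v, dotp (S *m v) v <= rho * dotp (Q *m v) v.

(** Writing [q] and [s] for the two forms, [rho q^(m+2) - s^(m+2) = q (rho q^(m+1) - s^(m+1)) + (q -
    s) s^(m+1)], and the Schur product theorem applies to both summands. *)
Lemma psd_kernel_powB m : psd_kernel (fun u v =>
  rho * dotp (Q *m u) v ^+ m.+1 - dotp (S *m u) v ^+ m.+1).
Proof.
elim: m => [|m IH].
  have hE u v : dotp ((rho *: Q - S) *m u) v = rho * dotp (Q *m u) v - dotp (S *m u) v.
    by rewrite mulmxBl dotpDl dotpNl -scalemxAl dotpZl.
  under eq_fun do under eq_fun do rewrite !expr1 -hE.
  by apply: psd_kernel_form => v; rewrite hE subr_ge0.
have := psd_kernelD (psd_kernelM_form hQ IH)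
  (psd_kernelM_form hQS (psd_kernel_form_pow m.+1 hS)).
congr (psd_kernel _); apply/funext => u; apply/funext => v.
by rewrite mulmxBl dotpDl dotpNl !exprS; ring.
Qed.

(** The condition on [sg] keeps all coefficients of the series nonnegative, so the partial sums
    inherit positivity from the powers and pass it to the limit. *)
Lemma psd_kernel_hyperbB sg : `|sg| <= 1 -> psd_kernel (fun u v =>
  rho * hyperb sg (dotp (Q *m u) v) - hyperb sg (dotp (S *m u) v)).
Proof.
move=> sg1.
apply: (@psd_kernel_cvg _ _ (fun m u v => \sum_(i < m)
   (1 + sg * (-1) ^+ i.+1) / 2 / i.+1`!%:R *
   (rho * dotp (Q *m u) v ^+ i.+1 - dotp (S *m u) v ^+ i.+1))).
  move=> m; apply: (@psd_kernel_sum _ _ _ (fun i u v =>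
    (1 + sg * (-1) ^+ i.+1) / 2 / i.+1`!%:R *
     (rho * dotp (Q *m u) v ^+ i.+1 - dotp (S *m u) v ^+ i.+1))) => i.
  apply: psd_kernelZ; last exact: psd_kernel_powB.
  rewrite !mulr_ge0 ?invr_ge0 ?ler0n//.
  suff : `|sg * (-1) ^+ i.+1| <= 1 by rewrite ler_norml => /andP[+ _]; lra.
  by rewrite normrM normrX normrN1 expr1n mulr1.
move=> u v.
rewrite (_ : (fun m => _) = (fun m =>
    rho * (\sum_(i < m) (1 + sg * (-1) ^+ i.+1) / 2 / i.+1`!%:R * dotp (Q *m u) v ^+ i.+1)
    - \sum_(i < m) (1 + sg * (-1) ^+ i.+1) / 2 / i.+1`!%:R * dotp (S *m u) v ^+ i.+1)).
  by apply: cvgB; [apply: cvgMl_tmp|]; exact: cvg_hyperb.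
by apply/funext => m; rewrite mulr_sumr -sumrB; apply: eq_bigr => i _; ring.
Qed.

End Comparison.
End EuclideanForms.

(** * Bounded limits of trigonometric polynomials *)

Section TrigonometricClass.
Context {R : realType} {n : nat}.
Local Notation T := (n.-tuple R).

(* Induction over this class replaces the monotone class theorem: it contains
   every bounded measurable function (bclass_measurable_bounded). *)
Inductive bclass : (T -> R) -> Prop :=
| bclass_cos xi th : bclass (fun x => cos (dotp xi (col_of x) + th))
| bclass_lin a f g : bclass f -> bclass g -> bclass (fun x => a * f x + g x)
| bclass_lim (F : nat -> T -> R) (f : T -> R) (M : R) : (forall k, bclass (F k)) ->
    (forall k x, `|F k x| <= M) -> (forall x, (fun k => F k x) @ \oo --> f x) ->
    bclass f.

Lemma bclass_bounded f : bclass f -> exists M, forall x, `|f x| <= M.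
Proof.
elim => {f} [xi th|a f g _ [M hM] _ [L hL]|F f M _ _ hM Ff].
- by exists 1 => x; exact: cos_max.
- exists (`|a| * M + L) => x; rewrite (le_trans (ler_normD _ _))// lerD// normrM.
  by rewrite ler_wpM2l.
- exists M => x.
  have h : (fun k => `|F k x|) @ \oo --> `|f x| by apply: cvg_norm; exact: Ff.
  by apply: (ler_cvg_to h (cvg_cst M)); exact: nearW.
Qed.

Lemma bclass_cst a : bclass (fun _ => a).
Proof.
have h0 : bclass (fun _ => 0).
  rewrite (_ : (fun _ => 0) = (fun x => cos (dotp 0 (col_of x) + pi / 2))).
    exact: bclass_cos.
  by apply/funext => x; rewrite dotp0l add0r cos_pihalf.
have h1 : bclass (fun _ => 1).
  rewrite (_ : (fun _ => 1) = (fun x => cos (dotp 0 (col_of x) + 0))).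
    exact: bclass_cos.
  by apply/funext => x; rewrite dotp0l add0r cos0.
have := bclass_lin a h1 h0.
by under eq_fun do rewrite mulr1 addr0.
Qed.

Lemma bclassD f g : bclass f -> bclass g -> bclass (fun x => f x + g x).
Proof. by move=> hf hg; have := bclass_lin 1 hf hg; under eq_fun do rewrite mul1r. Qed.

Lemma bclassZ a f : bclass f -> bclass (fun x => a * f x).
Proof. by move=> hf; have := bclass_lin a hf (bclass_cst 0); under eq_fun do rewrite addr0. Qed.

Lemma bclassB f g : bclass f -> bclass g -> bclass (fun x => f x - g x).
Proof.
move=> hf hg; have := bclass_lin (-1) hg hf.
by under eq_fun do rewrite mulN1r addrC.
Qed.

(** First half of a two-stage induction: products with a generator, by the product-to-sum formula.
    [bclassM] then inducts on the factor that is a generator here. *)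
Lemma bclass_cosM xi th f :
  bclass f -> bclass (fun x => cos (dotp xi (col_of x) + th) * f x).
Proof.
elim => {f} [xi' th'|a f g _ hf _ hg|F f M _ hF hM Ff].
- rewrite (_ : (fun x => _) = fun x =>
    2^-1 * cos (dotp (xi + xi') (col_of x) + (th + th')) +
    2^-1 * cos (dotp (xi - xi') (col_of x) + (th - th'))).
    by apply: bclass_lin; [|apply: bclassZ]; exact: bclass_cos.
  apply/funext => x; rewrite !dotpDl dotpNl addrACA.
  rewrite (_ : dotp xi _ - dotp xi' (col_of x) + (th - th') =
    (dotp xi (col_of x) + th) - (dotp xi' (col_of x) + th')); last by ring.
  by move: (_ + th) (_ + th') => u v; rewrite cosB cosD; field.
- by rewrite (_ : (fun x => _) = (fun x => a * (cos (dotp xi (col_of x) + th) * f x)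
     + cos (dotp xi (col_of x) + th) * g x)); [exact: bclass_lin|apply/funext => x; ring].
- apply: (bclass_lim hF (M := M)).
    move=> k x; rewrite normrM -[leRHS]mul1r ler_pM//; exact: cos_max.
  by move=> x; apply: cvgMl_tmp; exact: Ff.
Qed.

Lemma bclassM f g : bclass f -> bclass g -> bclass (fun x => f x * g x).
Proof.
move=> hf hg; have [L hL] := bclass_bounded hg.
elim: hf => {f} [xi th|a f h _ hf _ hh|F f M _ hF hM Ff].
- exact: bclass_cosM.
- by rewrite (_ : (fun x => _) = (fun x => a * (f x * g x) + h x * g x));
    [exact: bclass_lin|apply/funext => x; ring].
- apply: (bclass_lim hF (M := M * L)).
    by move=> k x; rewrite normrM ler_pM.
  by move=> x; apply: cvgMr_tmp; exact: Ff.
Qed.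

Lemma bclassX m f : bclass f -> bclass (fun x => f x ^+ m).
Proof.
move=> hf; elim: m => [|m IH].
  by under eq_fun do rewrite expr0; exact: bclass_cst.
by under eq_fun do rewrite exprS; exact: bclassM.
Qed.

Lemma bclass_sum (I : Type) (r : seq I) (F : I -> T -> R) :
  (forall i, bclass (F i)) -> bclass (fun x => \sum_(i <- r) F i x).
Proof.
move=> hF; elim: r => [|i r IH].
  by under eq_fun do rewrite big_nil; exact: bclass_cst.
by under eq_fun do rewrite big_cons; exact: bclassD.
Qed.

Lemma exprn_le_expRN (y : R) (m : nat) : 0 <= y <= 1 ->
  (1 - y) ^+ m <= expR (- (m%:R * y)).
Proof.
move=> /andP[y0 y1]; rewrite -mulrN expRM_natl lerXn2r ?nnegrE ?subr_ge0 ?expR_ge0//.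
exact: expR_ge1Dx.
Qed.

Lemma bernoulli_ge (y : R) (m : nat) : -1 <= y -> 1 + m%:R * y <= (1 + y) ^+ m.
Proof.
move=> y1; elim: m => [|m IH]; first by rewrite mul0r addr0 expr0.
rewrite exprS; apply: (@le_trans _ _ ((1 + y) * (1 + m%:R * y))).
  rewrite -natr1; have := mulr_ge0 (ler0n R m) (sqr_ge0 y); lra.
by rewrite ler_wpM2l//; lra.
Qed.

Lemma cvg_natmul_geometric (z : R) : 0 <= z < 1 ->
  (fun m => m%:R * z ^+ m) @ \oo --> (0 : R).
Proof.
(* The arithmetic-geometric mean inequality gives [z <= w ^+ 2]. Of the two factors [w ^+ m] one
   absorbs [m], since Bernoulli for [w^-1 = 1 + h] yields [m w^m <= h^-1]; the other tends to 0. *)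
move=> /andP[z0 z1]; pose w : R := (1 + z) / 2; pose h := w^-1 - 1.
have w0 : 0 < w by rewrite /w; lra.
have w1 : w < 1 by rewrite /w; lra.
have h0 : 0 < h by rewrite subr_gt0 invf_gt1.
have zw : z <= w * w by rewrite /w; have := sqr_ge0 (1 - z); lra.
apply: (@squeeze_cvgr _ _ _ _ (fun=> 0) (fun m => h^-1 * w ^+ m)).
- apply: nearW => m; rewrite mulr_ge0 ?exprn_ge0//=.
  apply: (@le_trans _ _ (m%:R * (w ^+ m * w ^+ m))).
    by rewrite ler_wpM2l// -exprMn lerXn2r// nnegrE// mulr_ge0// ltW.
  rewrite mulrA ler_wpM2r ?exprn_ge0 ?(ltW w0)// -[leRHS]mul1r ler_pdivlMr//.
  have : 1 + m%:R * h <= w ^- m.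
    rewrite -exprVn (_ : w^-1 = 1 + h); last by rewrite /h; ring.
    by apply: bernoulli_ge; lra.
  rewrite -[leRHS]mul1r ler_pdivlMr ?exprn_gt0//; apply: le_trans.
  by rewrite mulrDl mul1r mulrAC lerDr exprn_ge0// ltW.
- exact: cvg_cst.
- rewrite -[X in _ --> X](mulr0 h^-1); apply: cvgMl_tmp.
  by apply: cvg_expr; rewrite ger0_norm ?ltW.
Qed.

(* Brosowski--Deutsch polynomials; the extra factor [m] in the exponent makes
   the limit at [y = 1/2] equal to [0]. *)
Lemma cvg_step_poly (y : R) : 0 <= y <= 1 ->
  (fun m => (1 - y ^+ m) ^+ (m * 2 ^ m)) @ \oo --> ((y < 2^-1)%R%:R : R).
Proof.
move=> /andP[y0 y1].
have yX m : 0 <= y ^+ m <= 1 by rewrite exprn_ge0//= exprn_ile1.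
case: ltP => h /=.
  apply: (@squeeze_cvgr _ _ _ _ (fun m => 1 - m%:R * (2 * y) ^+ m) (fun=> 1)).
  - apply: nearW => m; have /andP[a b] := yX m; apply/andP; split.
      have := @bernoulli_ge (- y ^+ m) (m * 2 ^ m).
      by rewrite natrM natrX exprMn mulrN -mulrA; apply; rewrite lerN2.
    by rewrite exprn_ile1// ?subr_ge0// lerBlDr lerDl.
  - rewrite -[X in _ --> X]subr0; apply: cvgB; first exact: cvg_cst.
    by apply: cvg_natmul_geometric; lra.
  - exact: cvg_cst.
apply: (@squeeze_cvgr _ _ _ _ (fun=> 0) (fun m => expR (-1) ^+ m)).
- apply: nearW => m; have /andP[a b] := yX m; apply/andP; split.
    by rewrite exprn_ge0// subr_ge0.
  apply: (le_trans (exprn_le_expRN _ (yX m))).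
  rewrite -expRM_natl ler_expR mulrN1 lerN2 natrM natrX -mulrA -exprMn.
  rewrite ler_peMr// exprn_ege1//; lra.
- exact: cvg_cst.
- apply: cvg_expr; rewrite ger0_norm ?expR_ge0// expR_lt1; lra.
Qed.

Lemma bclass_step f : bclass f -> (forall x, 0 <= f x <= 1) ->
  bclass (fun x => (f x < 2^-1)%R%:R).
Proof.
move=> hf f01.
apply: (@bclass_lim (fun m x => (1 - f x ^+ m) ^+ (m * 2 ^ m)) _ 1).
- by move=> m; apply/bclassX/bclassB; [exact: bclass_cst|exact: bclassX].
- move=> m x; have /andP[a b] := f01 x.
  have h0 : 0 <= 1 - f x ^+ m by rewrite subr_ge0 exprn_ile1.
  rewrite ger0_norm ?exprn_ge0// exprn_ile1// lerBlDr lerDl exprn_ge0//.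
- by move=> x; exact: cvg_step_poly.
Qed.

Lemma dotp_delta (i : 'I_n) a (x : T) : dotp (a *: delta_mx i 0) (col_of x) = a * tnth x i.
Proof.
rewrite dotpZl /dotp (bigD1 i)//= big1 ?addr0 ?mxE ?eqxx ?mul1r// => j ji.
by rewrite !mxE (negbTE ji) mul0r.
Qed.

(** The sign of a sine is periodic, but at frequency [1 / m.+1] the argument lies in [(-2, 2)] for
    large [m], where sine has the sign of its argument. Thresholding [f m] at one half and letting
    [m] grow therefore isolates the ray. *)
Lemma bclass_ray (i : 'I_n) a : bclass (fun x => (a < tnth x i)%R%:R).
Proof.
pose f (m : nat) x : R := (1 + sin ((a - tnth x i) / m.+1%:R)) / 2.
have f01 m x : 0 <= f m x <= 1.
  rewrite /f; have := sin_geN1 ((a - tnth x i) / m.+1%:R).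
  have := sin_le1 ((a - tnth x i) / m.+1%:R); lra.
have hf m : bclass (f m).
  rewrite (_ : f m = (fun x => 2^-1 *
     cos (dotp ((- m.+1%:R^-1) *: delta_mx i 0) (col_of x) + (a / m.+1%:R - pi / 2)) + 2^-1)).
    by apply: bclass_lin; [exact: bclass_cos|exact: bclass_cst].
  apply/funext => x; rewrite /f dotp_delta addrA cosBpihalf mulNr addrC.
  rewrite (_ : a / _ - _ = (a - tnth x i) / m.+1%:R); last by ring.
  by field.
apply: (bclass_lim (fun m => bclass_step (hf m) (f01 m)) (M := 1)).
  by move=> m x; case: ltP => _; rewrite ?normr1 ?normr0.
move=> x; apply: cvg_near_cst.
have hE m y : f m y < 2^-1 = (sin ((a - tnth y i) / m.+1%:R) < 0).
  by rewrite /f; apply/idP/idP; lra.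
near=> m.
have small : `|(a - tnth x i) / m.+1%:R| < 2.
  rewrite normrM normfV [X in _ / X]ger0_norm// ltr_pdivrMr//.
  apply: (@lt_le_trans _ _ m.+1%:R); last by rewrite ler_peMl// ler1n.
  apply: (@lt_trans _ _ m%:R); last by rewrite ltr_nat.
  by near: m; exact: nbhs_infty_gtr.
rewrite hE; congr (nat_of_bool _)%:R.
have m0 : 0 < m.+1%:R^-1 :> R by rewrite invr_gt0.
have [ax|ax|ax] := ltgtP a (tnth x i).
- rewrite -oppr_gt0 -sinN sin2_gt0//; move: small.
  rewrite -normrN ltr_norml => /andP[_ ->]; rewrite andbT -mulNr opprB mulr_gt0// subr_gt0//.
- apply/negbTE; rewrite -leNgt ltW// sin2_gt0//; move: small.
  rewrite ltr_norml => /andP[_ ->]; rewrite andbT mulr_gt0// subr_gt0//.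
- by rewrite ax subrr mul0r sin0 ltxx.
Unshelve. all: by end_near. Qed.

Lemma bclass_indicC (A : set T) : bclass \1_A -> bclass \1_(~` A).
Proof.
move=> h; rewrite (_ : \1_(~` A) = (fun x => 1 - \1_A x) :> (T -> R)).
  by apply: bclassB => //; exact: bclass_cst.
by apply/funext => x; rewrite !indicE in_setC; case: (_ \in _); rewrite ?subrr ?subr0.
Qed.

(** The indicator of the complement is the bounded limit of the products of [1 - \1_(F k)]. Closure
    under products thus handles overlapping sets, and no pi-lambda argument is required. *)
Lemma bclass_indic_bigcup (F : nat -> set T) :
  (forall k, bclass \1_(F k)) -> bclass \1_(\bigcup_k F k).
Proof.
move=> hF.
have hG m : bclass (fun x => \prod_(k < m) (1 - \1_(F k) x)).
  elim: m => [|m IH].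
    by under eq_fun do rewrite big_ord0; exact: bclass_cst.
  under eq_fun do rewrite big_ord_recr /=; apply: bclassM => //.
  by apply: bclassB => //; exact: bclass_cst.
have h01 k (x : T) : 0 <= 1 - (\1_(F k) x : R) <= 1.
  by rewrite indicE; case: (_ \in _); rewrite ?subrr ?subr0 lexx ler01.
rewrite (_ : \1_(\bigcup_k F k) = (fun x => 1 - (1 - \1_(\bigcup_k F k) x)) :> (T -> R));
  last by apply/funext => x; ring.
apply: bclassB; first exact: bclass_cst.
apply: (bclass_lim hG (M := 1)).
  move=> m x; rewrite normr_prod; elim: m => [|m IH]; first by rewrite big_ord0.
  have /andP[a b] := h01 m x.
  by rewrite big_ord_recr /= mulr_ile1 ?prodr_ge0// ger0_norm.
move=> x; apply: cvg_near_cst; rewrite indicE.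
have [H|nx] := pselect ((\bigcup_k F k) x); [rewrite (mem_set H) subrr|]; last first.
  rewrite memNset// subr0; apply: nearW => m; apply: big1 => k _.
  by rewrite indicE memNset ?subr0// => Fk; apply: nx; exists k.
have [k _ Fkx] := H.
near=> m; have km : (k < m)%N by near: m; exact: nbhs_infty_gt.
by rewrite (bigD1 (Ordinal km))//= indicE mem_set// subrr mul0r.
Unshelve. all: by end_near. Qed.

(** Two generation arguments in a row: coordinate preimages generate the product sigma-algebra, and
    the sets [Y] of reals whose coordinate preimage is good form a sigma-algebra containing the
    rays. *)
Lemma bclass_indic (A : set T) : measurable A -> bclass \1_A.
Proof.
pose C := [set A : set T | bclass \1_A].
have sC : sigma_algebra setT C.
  split.
  - by rewrite /C /= indic0; exact: bclass_cst.
  - by move=> B hB; rewrite setTD; exact: bclass_indicC.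
  - by move=> F hF; exact: bclass_indic_bigcup.
move=> mA; apply: (smallest_sub sC _ mA).
rewrite -bigcup_seq; apply: bigcup_sub => i _ B [Y mY <-]; rewrite setTI.
pose C' := [set Y : set R | C ((@tnth n R)^~ i @^-1` Y)].
have sC' : sigma_algebra setT C'.
  split.
  - by rewrite /C' /= preimage_set0; case: sC.
  - by move=> Z hZ; case: sC => _ + _; exact.
  - by move=> F hF; rewrite /C' /= preimage_bigcup; case: sC => _ _; apply.
have mGY : (RGenOInfty.G (R := R)).-sigma.-measurable Y.
  by rewrite -RGenOInfty.measurableE.
apply: (smallest_sub sC' _ mGY) => _ [a ->]; rewrite /C' /C /=.
have := bclass_ray i a; congr bclass; apply/funext => x; rewrite indicE.
congr (nat_of_bool _)%:R; apply/idP/idP.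
  by move=> ax; rewrite in_setE/= in_itv/= ax.
by rewrite in_setE/= in_itv/= andbT.
Qed.

Import HBSimple HBNNSimple.

Lemma bclass_measurable_bounded (f : T -> R) (M : R) : measurable_fun setT f ->
  (forall x, `|f x| <= M) -> bclass f.
Proof.
move=> mf fM.
(* Approximation by simple functions works for nonnegative functions, hence the shift by [M]; the
   approximants then stay between 0 and [M + M]. *)
pose g x : \bar R := (f x + M)%:E.
have mg : measurable_fun [set: T] g.
  by apply/measurable_EFinP; apply: measurable_funD => //; exact: measurable_cst.
have g0 x : (setT x -> 0 <= g x)%E.
  by move=> _; rewrite lee_fin; have := fM x; rewrite ler_norml => /andP[]; lra.
pose h := nnsfun_approx measurableT mg.
have hg x : (fun k => h k x) @ \oo --> f x + M.
  have := cvg_nnsfun_approx measurableT mg g0 (x := x) Logic.I.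
  by move=> /fine_cvgP[_]; exact.
suff hh : bclass (fun x => f x + M).
  have := bclassB hh (bclass_cst M); congr bclass; apply/funext => x; ring.
apply: (@bclass_lim h _ (M + M)) => //.
  move=> k; rewrite (_ : (h k : T -> R) = (fun x => \sum_(y \in range (h k))
      y * \1_(h k @^-1` [set y]) x)); last by apply/funext => x; exact: fimfunE.
  under eq_fun do rewrite fsbig_finite//=.
  apply: bclass_sum => r; apply: bclassZ; apply: bclass_indic.
  by rewrite -[_ @^-1` _]setTI; exact: measurable_funP.
move=> k x; rewrite ger0_norm//.
apply: (@le_trans _ _ (f x + M)); last by rewrite lerD2r (le_trans (ler_norm _)).
by rewrite -lee_fin /h nnsfun_approxE le_approx.
Qed.

End TrigonometricClass.

(** * Gaussian integrals of trigonometric polynomials *)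

Section BoundedMeasurable.
Context {d : measure_display} {T : measurableType d} {R : realType}.
Implicit Types (f g : T -> R) (mu : probability T R).

(** Such functions are integrable for all probability measures at once, which suits a kernel whose
    measure varies with the point. *)
Definition bmeas f : Prop :=
  measurable_fun setT f /\ exists M : R, forall x, `|f x| <= M.

Lemma bmeas_cst a : bmeas (fun _ => a).
Proof. by split; [exact: measurable_cst|exists `|a|]. Qed.

Lemma bmeasD f g : bmeas f -> bmeas g -> bmeas (fun x => f x + g x).
Proof.
move=> [mf [M fM]] [mg [L gL]]; split; first exact: measurable_funD.
by exists (M + L) => x; rewrite (le_trans (ler_normD _ _))// lerD.
Qed.

Lemma bmeasM f g : bmeas f -> bmeas g -> bmeas (fun x => f x * g x).
Proof.
move=> [mf [M fM]] [mg [L gL]]; split; first exact: measurable_funM.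
by exists (M * L) => x; rewrite normrM ler_pM.
Qed.

Lemma bmeasZ a f : bmeas f -> bmeas (fun x => a * f x).
Proof. by move=> hf; apply: bmeasM => //; exact: bmeas_cst. Qed.

Lemma bmeasB f g : bmeas f -> bmeas g -> bmeas (fun x => f x - g x).
Proof.
move=> hf hg; have := bmeasD hf (bmeasZ (-1) hg).
by under eq_fun do rewrite mulN1r.
Qed.

Lemma bmeasX f : bmeas f -> bmeas (fun x => f x ^+ 2).
Proof. by move=> hf; under eq_fun do rewrite expr2; exact: bmeasM. Qed.

Lemma bmeas_integrable mu f : bmeas f -> mu.-integrable setT (EFin \o f).
Proof.
move=> [mf [M fM]]; apply: measurable_bounded_integrable => //.
  by rewrite [X in (X < _)%E](_ : _ = 1%E) ?ltry//; exact: probability_setT.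
exists M; split; first exact: num_real.
by move=> x Mx y _; apply: le_trans (fM y) _; exact: ltW.
Qed.

Lemma bintD mu f g : bmeas f -> bmeas g ->
  \int[mu]_x (f x + g x) = \int[mu]_x f x + \int[mu]_x g x.
Proof. by move=> hf hg; rewrite RintegralD//; exact: bmeas_integrable. Qed.

Lemma bintB mu f g : bmeas f -> bmeas g ->
  \int[mu]_x (f x - g x) = \int[mu]_x f x - \int[mu]_x g x.
Proof. by move=> hf hg; rewrite RintegralB//; exact: bmeas_integrable. Qed.

Lemma bintZ mu a f : bmeas f -> \int[mu]_x (a * f x) = a * \int[mu]_x f x.
Proof. by move=> hf; rewrite RintegralZl//; exact: bmeas_integrable. Qed.

Lemma bint_cst mu a : \int[mu]_x a = a.
Proof.
rewrite Rintegral_cst// [X in fine X](_ : _ = 1%E) ?mulr1//.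
exact: probability_setT.
Qed.

Lemma ler_bint mu f g : bmeas f -> bmeas g -> (forall x, f x <= g x) ->
  \int[mu]_x f x <= \int[mu]_x g x.
Proof. by move=> hf hg fg; apply: le_Rintegral => //; exact: bmeas_integrable. Qed.

Lemma bint_EFin mu f : bmeas f -> (\int[mu]_x (f x)%:E)%E = (\int[mu]_x f x)%:E.
Proof.
move=> hf; rewrite /Rintegral fineK//.
by apply: integrable_fin_num => //; exact: bmeas_integrable.
Qed.

Lemma bint_norm_le mu f (M : R) : bmeas f -> (forall x, `|f x| <= M) -> `|\int[mu]_x f x| <= M.
Proof.
move=> hf fM; apply: (@le_trans _ _ (\int[mu]_x `|f x|)).
  by apply: le_normr_Rintegral => //; exact: bmeas_integrable.
rewrite -[leRHS](bint_cst mu); apply: ler_bint => //; last exact: bmeas_cst.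
case: hf => mf _; split; first exact: measurableT_comp.
by exists M => x; rewrite normr_id.
Qed.

Lemma bint_sum mu (I : Type) (r : seq I) (F : I -> T -> R) :
  (forall i, bmeas (F i)) -> bmeas (fun x => \sum_(i <- r) F i x) /\
  \int[mu]_x (\sum_(i <- r) F i x) = \sum_(i <- r) \int[mu]_x F i x.
Proof.
move=> hF; elim: r => [|i r [h1 h2]].
  rewrite big_nil; under eq_fun do rewrite big_nil.
  by split; [exact: bmeas_cst|exact: bint_cst].
rewrite big_cons -h2 -bintD//; under eq_fun do rewrite big_cons.
by split=> //; exact: bmeasD.
Qed.

Lemma bint_cvg mu (F : nat -> T -> R) f (M : R) : (forall k, measurable_fun setT (F k)) ->
  (forall k x, `|F k x| <= M) -> (forall x, (fun k => F k x) @ \oo --> f x) ->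
  bmeas f /\ (fun k => \int[mu]_x F k x) @ \oo --> \int[mu]_x f x.
Proof.
move=> mF FM Ff.
have mf : measurable_fun setT f.
  by apply: (measurable_fun_cvg mF) => x _; exact: Ff.
have fM x : `|f x| <= M.
  have h : (fun k => `|F k x|) @ \oo --> `|f x| by apply: cvg_norm; exact: Ff.
  by apply: (ler_cvg_to h (cvg_cst M)); exact: nearW.
have bf : bmeas f by split => //; exists M.
split => //.
have bF k : bmeas (F k) by split => //; exists M.
have iM : mu.-integrable setT (EFin \o (fun=> M)).
  by apply: bmeas_integrable; exact: bmeas_cst.
have [|||||_ _ h] := @dominated_convergence _ _ _ mu setT measurableT
  (fun k => EFin \o F k) (EFin \o f) (EFin \o (fun=> M)).
- by move=> k; exact/measurable_EFinP.
- by exact/measurable_EFinP.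
- by apply: aeW => x _ /=; apply/cvg_EFin; [exact: nearW|exact: Ff].
- exact: iM.
- by apply: aeW => x k _ /=; rewrite lee_fin.
move: h; rewrite /= bint_EFin// => /fine_cvgP[_]; apply: cvg_trans.
by apply: near_eq_cvg; apply: nearW => k /=; rewrite bint_EFin.
Qed.

(** Nonnegativity of the variance; it serves as Jensen's inequality under the measures [K x]. *)
Lemma bint_sqr_le mu f : bmeas f -> (\int[mu]_x f x) ^+ 2 <= \int[mu]_x f x ^+ 2.
Proof.
move=> hf; set m := \int[mu]_x f x.
have : 0 <= \int[mu]_x ((f x - m) ^+ 2) by apply: Rintegral_ge0 => x _; exact: sqr_ge0.
rewrite (_ : (fun x => _) = (fun x => f x ^+ 2 + ((- (m *+ 2)) * f x + m ^+ 2))); last first.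
  by apply/funext => x; ring.
have h1 := bmeasX hf; have h2 := bmeasZ (- (m *+ 2)) hf; have h3 := bmeas_cst (m ^+ 2).
rewrite bintD//; last exact: bmeasD.
by rewrite bintD// bintZ// bint_cst -/m; lra.
Qed.

Lemma bint_sqr_subr_le mu f : bmeas f ->
  \int[mu]_x ((f x - \int[mu]_y f y) ^+ 2) <= \int[mu]_x f x ^+ 2.
Proof.
move=> hf; set m := \int[mu]_x f x.
rewrite (_ : (fun x => (f x - m) ^+ 2) =
  (fun x => f x ^+ 2 + ((- (m *+ 2)) * f x + m ^+ 2))); last first.
  by apply/funext => x; ring.
have h1 := bmeasX hf; have h2 := bmeasZ (- (m *+ 2)) hf; have h3 := bmeas_cst (m ^+ 2).
rewrite bintD//; last exact: bmeasD.
by rewrite bintD// bintZ// bint_cst -/m; have := sqr_ge0 m; lra.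
Qed.

End BoundedMeasurable.

Section GaussianTrig.
Context {R : realType} {n : nat}.
Local Notation T := (n.-tuple R).
Implicit Types (mu : probability T R) (a xi : 'cV[R]_n) (Q : 'M[R]_n).

Lemma bmeas_cos xi th : bmeas (fun x : T => cos (dotp xi (col_of x) + th)).
Proof.
split; last by exists 1 => x; exact: cos_max.
apply: (@measurableT_comp _ _ _ _ _ _ (@cos R)).
  by apply: continuous_measurable_fun; exact: continuous_cos.
apply: measurable_funD; last exact: measurable_cst.
apply: measurable_sum => i; apply: measurable_funM; first exact: measurable_cst.
under eq_fun do rewrite mxE; exact: measurable_tnth.
Qed.

Lemma gaussian_cos mu a Q xi th : is_gaussian mu a Q ->
  \int[mu]_x cos (dotp xi (col_of x) + th) =
  cos (dotp xi a + th) * expR (- dotp (Q *m xi) xi / 2).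
Proof.
move=> /(_ xi)[hc hs].
have Ec : \int[mu]_x cos (dotp xi (col_of x)) =
    cos (dotp xi a) * expR (- dotp (Q *m xi) xi / 2).
  by rewrite /Rintegral hc.
have Es : \int[mu]_x sin (dotp xi (col_of x)) =
    sin (dotp xi a) * expR (- dotp (Q *m xi) xi / 2).
  by rewrite /Rintegral hs.
have bc : bmeas (fun x : T => cos (dotp xi (col_of x))).
  by have := bmeas_cos xi 0; under eq_fun do rewrite addr0.
have bs : bmeas (fun x : T => sin (dotp xi (col_of x))).
  by have := bmeas_cos xi (- (pi / 2)); under eq_fun do rewrite cosBpihalf.
rewrite (_ : (fun x => _) = (fun x => cos th * cos (dotp xi (col_of x)) -
  sin th * sin (dotp xi (col_of x)))); last first.
  by apply/funext => x; rewrite cosD; ring.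
by rewrite bintB ?(bintZ _ _ bc) ?(bintZ _ _ bs) ?Ec ?Es ?cosD;
  [ring|exact: bmeasZ|exact: bmeasZ].
Qed.

(** The frequencies [xi + xi'] and [xi - xi'] have quadratic forms [u + v + 2 q] and [u + v - 2 q],
    the symmetry of [Q] merging the cross terms; the factors [expR (- q)] and [expR q] recombine
    into [cosh q] and [sinh q]. The 1 split off [cosh q] accounts for the product of the two
    means. *)
Lemma gaussian_cosM mu a Q xi xi' th th' : is_gaussian mu a Q -> Q^T = Q ->
  \int[mu]_x (cos (dotp xi (col_of x) + th) * cos (dotp xi' (col_of x) + th')) =
  expR (- dotp (Q *m xi) xi / 2) * expR (- dotp (Q *m xi') xi' / 2) *
  (cos (dotp xi a + th) * cos (dotp xi' a + th') * (1 + hyperb 1 (dotp (Q *m xi) xi'))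
   + sin (dotp xi a + th) * sin (dotp xi' a + th') * hyperb (-1) (dotp (Q *m xi) xi')).
Proof.
move=> hg sQ.
rewrite (_ : (fun x => _) = fun x =>
    2^-1 * cos (dotp (xi + xi') (col_of x) + (th + th')) +
    2^-1 * cos (dotp (xi - xi') (col_of x) + (th - th'))); last first.
  apply/funext => x; rewrite !dotpDl dotpNl addrACA.
  rewrite (_ : dotp xi _ - dotp xi' (col_of x) + (th - th') =
    (dotp xi (col_of x) + th) - (dotp xi' (col_of x) + th')); last by ring.
  by move: (_ + th) (_ + th') => u v; rewrite cosB cosD; field.
have b1 := bmeas_cos (xi + xi') (th + th'); have b2 := bmeas_cos (xi - xi') (th - th').
rewrite bintD; [|exact: bmeasZ|exact: bmeasZ].
rewrite (bintZ _ _ b1) (bintZ _ _ b2) !(gaussian_cos _ _ hg).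
have sym : dotp (Q *m xi') xi = dotp (Q *m xi) xi' by rewrite dotp_tr sQ dotpC.
rewrite !mulmxDr !mulmxN !dotpDl !dotpDr !dotpNl !dotpNr sym.
rewrite (_ : dotp xi a + dotp xi' a + (th + th') = (dotp xi a + th) + (dotp xi' a + th')); last by ring.
rewrite (_ : dotp xi a - dotp xi' a + (th - th') = (dotp xi a + th) - (dotp xi' a + th')); last by ring.
set q := dotp (Q *m xi) xi'; set u := dotp (Q *m xi) xi; set v := dotp (Q *m xi') xi'.
rewrite (_ : - (u + q + (q + v)) / 2 = - u / 2 + - v / 2 + - q); last by field.
rewrite (_ : - (u + - q + (- q + - - v)) / 2 = - u / 2 + - v / 2 + q); last by field.
rewrite !expRD /hyperb; move: (_ + th) (_ + th') => x y; rewrite cosB cosD.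
by move: (expR (- u / 2)) (expR (- v / 2)) (expR q) (expR (- q)) => A B C D; field.
Qed.

(** An entry [(c, (xi, th))] is a coefficient, a frequency and a phase. Phases encode the sines and
    absorb the translation by [g] in [transport]. *)
Definition trigpoly (L : seq (R * ('cV[R]_n * R))) (x : T) : R :=
  \sum_(p <- L) p.1 * cos (dotp p.2.1 (col_of x) + p.2.2).

Lemma bmeas_trigpoly L : bmeas (trigpoly L).
Proof.
elim: L => [|p L IH].
  by rewrite /trigpoly; under eq_fun do rewrite big_nil; exact: bmeas_cst.
rewrite /trigpoly; under eq_fun do rewrite big_cons.
by apply: bmeasD => //; apply: bmeasZ; exact: bmeas_cos.
Qed.

Definition gcoef Q (p : R * ('cV[R]_n * R)) : R :=
  p.1 * expR (- dotp (Q *m p.2.1) p.2.1 / 2).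

Lemma gaussian_trigpoly mu a Q L : is_gaussian mu a Q ->
  \int[mu]_x trigpoly L x =
  \sum_(p <- L) gcoef Q p * cos (dotp p.2.1 a + p.2.2).
Proof.
move=> hg; rewrite /trigpoly.
have [_ ->] := @bint_sum _ _ _ mu _ L
   (fun p x => p.1 * cos (dotp p.2.1 (col_of x) + p.2.2))
   (fun p => bmeasZ _ (bmeas_cos _ _)).
apply: eq_bigr => p _; rewrite bintZ; last exact: bmeas_cos.
by rewrite (gaussian_cos _ _ hg) /gcoef; ring.
Qed.

(* For [S = Q] this is the variance of [trigpoly L] under the Gaussian measure
   with mean [a] and covariance [Q]. *)
Definition gvar a Q S (L : seq (R * ('cV[R]_n * R))) : R :=
  \sum_(p <- L) \sum_(q <- L) gcoef Q p * gcoef Q q *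
   (cos (dotp p.2.1 a + p.2.2) * cos (dotp q.2.1 a + q.2.2) *
      hyperb 1 (dotp (S *m p.2.1) q.2.1)
    + sin (dotp p.2.1 a + p.2.2) * sin (dotp q.2.1 a + q.2.2) *
      hyperb (-1) (dotp (S *m p.2.1) q.2.1)).

Lemma gaussian_trigpoly_sqr mu a Q L : is_gaussian mu a Q -> Q^T = Q ->
  \int[mu]_x trigpoly L x ^+ 2 =
  gvar a Q Q L + (\int[mu]_x trigpoly L x) ^+ 2.
Proof.
move=> hg sQ; rewrite (gaussian_trigpoly _ hg).
rewrite (_ : (fun x => _) = (fun x => \sum_(p <- L) (\sum_(q <- L)
   p.1 * q.1 * (cos (dotp p.2.1 (col_of x) + p.2.2) * cos (dotp q.2.1 (col_of x) + q.2.2))))); last first.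
  apply/funext => x; rewrite /trigpoly expr2 big_distrlr /=.
  by do 2 apply: eq_bigr => ? _; ring.
have b0 p q : bmeas (fun x : T => p.1 * q.1 * (cos (dotp p.2.1 (col_of x) + p.2.2) *
    cos (dotp q.2.1 (col_of x) + q.2.2))).
  by apply: bmeasZ; apply: bmeasM; exact: bmeas_cos.
have [_ ->] := @bint_sum _ _ _ mu _ L
   (fun p x => \sum_(q <- L) p.1 * q.1 * (cos (dotp p.2.1 (col_of x) + p.2.2) *
    cos (dotp q.2.1 (col_of x) + q.2.2)))
   (fun p => (@bint_sum _ _ _ mu _ L _ (b0 p)).1).
rewrite expr2 big_distrlr /= /gvar -big_split /=; apply: eq_bigr => p _.
have [_ ->] := @bint_sum _ _ _ mu _ L _ (b0 p).
rewrite -big_split /=; apply: eq_bigr => q _.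
rewrite bintZ; last by apply: bmeasM; exact: bmeas_cos.
rewrite (gaussian_cosM _ _ _ _ hg sQ) /gcoef.
by move: (hyperb _ _) (hyperb _ _) (expR _) (expR _) => *; ring.
Qed.

(** The products of cosines and of sines factor over [p] and [q], so they move into the weights; the
    comparisons for [cosh - 1] and for [sinh], with their respective weights, add up to the
    claim. *)
Lemma gvar_le a Q S rho L : dual_psd Q -> dual_psd S -> dual_psd (Q - S) ->
  (forall v, dotp (S *m v) v <= rho * dotp (Q *m v) v) ->
  gvar a Q S L <= rho * gvar a Q Q L.
Proof.
move=> hQ hS hQS hrho.
have h1 := psd_kernel_hyperbB hQ hS hQS hrho (sg := 1).
have h2 := psd_kernel_hyperbB hQ hS hQS hrho (sg := -1).
rewrite normrN normr1 in h2; rewrite normr1 in h1.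
have {}h1 := h1 (lexx 1) [seq (gcoef Q p * cos (dotp p.2.1 a + p.2.2), p.2.1) | p <- L].
have {}h2 := h2 (lexx 1) [seq (gcoef Q p * sin (dotp p.2.1 a + p.2.2), p.2.1) | p <- L].
rewrite -subr_ge0; have := addr_ge0 h1 h2; congr (_ <= _).
rewrite !big_map -big_split /= /gvar mulr_sumr -sumrB; apply: eq_bigr => p _.
rewrite !big_map -big_split /= mulr_sumr -sumrB; apply: eq_bigr => q _ /=.
by ring.
Qed.

End GaussianTrig.

(** * Gaussian transition kernels *)

Section GaussianKernel.
Context {R : realType} {n : nat}.
Local Notation T := (n.-tuple R).
Variables (nus nut : probability T R) (K : T -> probability T R).
Variables (gs gt g : 'cV[R]_n) (Qs Qt Qst U : 'M[R]_n) (rho : R).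
Hypotheses (nusG : is_gaussian nus gs Qs) (nutG : is_gaussian nut gt Qt).
Hypothesis KG : forall x, is_gaussian (K x) (U *m col_of x + g) Qst.
Hypotheses (gtE : gt = U *m gs + g) (QtE : Qt = U *m Qs *m U^T + Qst).
Hypotheses (sQs : Qs^T = Qs) (sQt : Qt^T = Qt).
Hypotheses (hS : dual_psd (U *m Qs *m U^T)) (hQst : dual_psd Qst).
Hypothesis rho_ge0 : 0 <= rho.
Hypothesis hrho : forall v,
  dotp (U *m Qs *m U^T *m v) v <= rho * dotp (Qt *m v) v.

(** The action of the transition operator on one term: the mean [U x + g] changes frequency and
    phase, the covariance [Qst] damps the coefficient. *)
Definition transport (p : R * ('cV[R]_n * R)) : R * ('cV[R]_n * R) :=
  (p.1 * expR (- dotp (Qst *m p.2.1) p.2.1 / 2), (U^T *m p.2.1, dotp p.2.1 g + p.2.2)).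

Lemma kernel_trigpoly L x : \int[K x]_y trigpoly L y = trigpoly (map transport L) x.
Proof.
rewrite (gaussian_trigpoly _ (KG x)) /trigpoly big_map; apply: eq_bigr => p _ /=.
rewrite /gcoef dotpDr addrA; congr (_ * cos (_ + _ + _)).
by rewrite dotpC dotp_tr dotpC.
Qed.

(** The damping by [Qst] at [xi] and that by [Qs] at [U^T xi] multiply to the damping by [Qt] at
    [xi], which is [QtE] read on quadratic forms. *)
Lemma transport_gcoef p : gcoef Qs (transport p) = gcoef Qt p.
Proof.
rewrite /gcoef /= -mulrA -expRD; congr (_ * expR _).
by rewrite QtE mulmxDl dotpDl -!mulmxA (dotp_tr U); field.
Qed.

Lemma transport_angle p :
  dotp (transport p).2.1 gs + (transport p).2.2 = dotp p.2.1 gt + p.2.2.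
Proof. by rewrite /= gtE dotpDr addrA dotpC -dotp_tr dotpC. Qed.

Lemma integral_transport L :
  \int[nus]_x trigpoly (map transport L) x = \int[nut]_x trigpoly L x.
Proof.
rewrite (gaussian_trigpoly _ nusG) (gaussian_trigpoly _ nutG) big_map.
by apply: eq_bigr => p _; rewrite transport_gcoef transport_angle.
Qed.

Lemma transport_contraction L :
  \int[nus]_x ((trigpoly (map transport L) x - \int[nut]_y trigpoly L y) ^+ 2)
  <= rho * \int[nut]_x trigpoly L x ^+ 2.
Proof.
set m := \int[nut]_y trigpoly L y.
have b := bmeas_trigpoly (map transport L).
rewrite (_ : (fun x => _) = (fun x => trigpoly (map transport L) x ^+ 2
    + ((- (m *+ 2)) * trigpoly (map transport L) x + m ^+ 2))); last first.
  by apply/funext => x; ring.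
rewrite bintD; [|exact: bmeasX|by apply: bmeasD; [exact: bmeasZ|exact: bmeas_cst]].
rewrite bintD; [|exact: bmeasZ|exact: bmeas_cst].
rewrite bintZ// bint_cst integral_transport -/m.
rewrite (gaussian_trigpoly_sqr _ nusG)// (gaussian_trigpoly_sqr _ nutG)//.
rewrite integral_transport -/m.
(* Weights and angles agree for the two measures. Only the cross terms [<Qs U^T xi, U^T xi'>] differ
   from those of [nut], and they are the kernel of [U Qs U^T]. *)
have -> : gvar gs Qs Qs (map transport L) = gvar gt Qt (U *m Qs *m U^T) L.
  rewrite /gvar big_map; apply: eq_bigr => p _; rewrite big_map; apply: eq_bigr => q _.
  by rewrite !transport_gcoef !transport_angle /= -!mulmxA [dotp (U *m _) _]dotp_tr.
have hQt : dual_psd Qt by rewrite QtE; exact: dual_psdD.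
have hQtS : dual_psd (Qt - U *m Qs *m U^T) by rewrite QtE addrAC subrr add0r.
have := gvar_le gt L hQt hS hQtS hrho.
by have := mulr_ge0 rho_ge0 (sqr_ge0 m); lra.
Qed.

(** Measurability in [x] has to be carried along with the invariance identity. A cosine has an
    explicit trigonometric image; a limit needs bounded convergence twice, under each [K x] and then
    under [nus]. *)
Lemma bclass_kernel f : bclass f -> [/\ bmeas f,
  measurable_fun setT (fun x => \int[K x]_y f y) &
  \int[nus]_x \int[K x]_y f y = \int[nut]_y f y].
Proof.
elim => {f} [xi th|a f h _ [bf mf ef] _ [bh mh eh]|F f M _ IH FM Ff].
- pose L := [:: (1 : R, (xi, th))].
  have LE : trigpoly L = (fun x => cos (dotp xi (col_of x) + th)).
    by apply/funext => x; rewrite /trigpoly big_cons big_nil mul1r addr0.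
  rewrite -LE; split; first exact: bmeas_trigpoly.
    by under eq_fun do rewrite kernel_trigpoly; exact: (bmeas_trigpoly _).1.
  rewrite -integral_transport; congr (Rintegral _ _ _).
  by apply/funext => x; rewrite kernel_trigpoly.
- have KE x : \int[K x]_y (a * f y + h y) = a * \int[K x]_y f y + \int[K x]_y h y.
    by rewrite bintD ?bintZ//; exact: bmeasZ.
  split; first by apply: bmeasD => //; exact: bmeasZ.
    under eq_fun do rewrite KE; apply: measurable_funD => //.
    by apply: measurable_funM => //; exact: measurable_cst.
  under [in LHS]eq_fun do rewrite KE.
  have bK q : bmeas q -> measurable_fun setT (fun x => \int[K x]_y q y) ->
      bmeas (fun x => \int[K x]_y q y).
    move=> bq mq; split => //; have [_ [M qM]] := bq; exists M => x.
    exact: bint_norm_le.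
  rewrite bintD; [|by apply: bmeasZ; exact: bK|exact: bK].
  rewrite bintZ; last exact: bK.
  by rewrite ef eh bintD ?bintZ//; exact: bmeasZ.
- have bF k : bmeas (F k) by case: (IH k).
  have cv mu := bint_cvg mu (fun k => (bF k).1) FM Ff.
  have bf := (cv nut).1.
  have [bKf cK] : bmeas (fun x => \int[K x]_y f y) /\
      (fun k => \int[nus]_x \int[K x]_y F k y) @ \oo --> \int[nus]_x \int[K x]_y f y.
    apply: (@bint_cvg _ _ _ nus (fun k x => \int[K x]_y F k y) _ M).
    + by move=> k; case: (IH k).
    + by move=> k x; exact: bint_norm_le.
    + by move=> x; exact: (cv (K x)).2.
  split => //; first exact: bKf.1.
  apply: (cvg_unique _ cK) => //.
  rewrite /= (_ : (fun k => _) = (fun k => \int[nut]_y F k y)); first exact: (cv nut).2.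
  by apply/funext => k; case: (IH k).
Qed.

Lemma bmeas_kernel f : bmeas f -> bmeas (fun x => \int[K x]_y f y) /\
  \int[nus]_x \int[K x]_y f y = \int[nut]_y f y.
Proof.
move=> bf; have [mf [M fM]] := bf.
have [_ mK e] := bclass_kernel (bclass_measurable_bounded mf fM).
by split => //; split => //; exists M => x; exact: bint_norm_le.
Qed.

Lemma bclass_trigpoly_dense f : bclass f -> bmeas f /\ forall e : R, 0 < e ->
  exists L, \int[nut]_x ((f x - trigpoly L x) ^+ 2) <= e.
Proof.
have sq2 (a b : R) : (a + b) ^+ 2 <= 2 * a ^+ 2 + 2 * b ^+ 2.
  by have := sqr_ge0 (a - b); lra.
elim => {f} [xi th|a f h _ [bf df] _ [bh dh]|F f M _ IH FM Ff].
- split; first exact: bmeas_cos.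
  move=> e e0; exists [:: (1 : R, (xi, th))].
  rewrite (_ : (fun x => _) = fun=> 0) ?bint_cst ?ltW//.
  apply/funext => x; rewrite /trigpoly big_cons big_nil mul1r addr0 subrr expr0n//.
- split; first by apply: bmeasD => //; exact: bmeasZ.
  move=> e e0.
  (* Dividing by [1 + a ^+ 2] allows [a = 0] and still keeps the first error, multiplied by
     [2 * a ^+ 2], below [e / 2]. *)
  have a1 : 0 < 1 + a ^+ 2 by have := sqr_ge0 a; lra.
  have e1 : 0 < e / 4 / (1 + a ^+ 2) by rewrite !divr_gt0.
  have e2 : 0 < e / 4 by rewrite divr_gt0.
  have [L1 h1] := df _ e1; have [L2 h2] := dh _ e2.
  exists (map (fun p => (a * p.1, p.2)) L1 ++ L2).
  have LE x : trigpoly (map (fun p => (a * p.1, p.2)) L1 ++ L2) x =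
      a * trigpoly L1 x + trigpoly L2 x.
    rewrite /trigpoly big_cat big_map /= mulr_sumr; congr (_ + _).
    by apply: eq_bigr => p _; rewrite mulrA.
  have b1 := bmeas_trigpoly L1; have b2 := bmeas_trigpoly L2.
  have c1 := bmeasZ (2 * a ^+ 2) (bmeasX (bmeasB bf b1)).
  have c2 := bmeasZ 2 (bmeasX (bmeasB bh b2)).
  apply: (@le_trans _ _ (\int[nut]_x (2 * a ^+ 2 * (f x - trigpoly L1 x) ^+ 2
      + 2 * (h x - trigpoly L2 x) ^+ 2))).
    apply: ler_bint; [|exact: bmeasD|].
      apply: bmeasX; apply: bmeasB; last exact: bmeas_trigpoly.
      by apply: bmeasD => //; exact: bmeasZ.
    move=> x; rewrite LE.
    have := sq2 (a * (f x - trigpoly L1 x)) (h x - trigpoly L2 x); lra.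
  rewrite bintD// !bintZ; [|exact: bmeasX (bmeasB _ _)|exact: bmeasX (bmeasB _ _)].
  have := ler_wpM2l (sqr_ge0 a) h1.
  have : a ^+ 2 * (e / 4 / (1 + a ^+ 2)) <= e / 4.
    rewrite mulrA ler_pdivrMr//; have := mulr_ge0 (ltW e2) (sqr_ge0 a); lra.
  lra.
- have bF k : bmeas (F k) by case: (IH k).
  have bf := (bint_cvg nut (fun k => (bF k).1) FM Ff).1.
  split => // e e0; have [_ [B fB]] := bf.
  have [_ cv] : bmeas (fun _ : T => 0 : R) /\
      (fun k => \int[nut]_x ((f x - F k x) ^+ 2)) @ \oo --> \int[nut]_x (0 : R).
    apply: (@bint_cvg _ _ _ nut (fun k x => (f x - F k x) ^+ 2) _ ((B + M) ^+ 2)).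
    + by move=> k; exact: (bmeasX (bmeasB bf (bF k))).1.
    + move=> k x; rewrite ger0_norm ?sqr_ge0// -real_normK ?num_real//.
      rewrite lerXn2r ?nnegrE ?(le_trans _ (fB x))//; last first.
        by rewrite (le_trans (ler_normB _ _))// lerD.
      by rewrite addr_ge0// ?(le_trans _ (fB x))// (le_trans _ (FM k x)).
    + move=> x; rewrite -[X in _ --> X](expr0n _ 2%N) -(subrr (f x)).
      by under eq_fun do rewrite expr2; rewrite expr2; apply: cvgM; apply: cvgB => //; exact: cvg_cst.
  have e4 : 0 < e / 4 by rewrite divr_gt0.
  rewrite bint_cst in cv.
  have [k hk] : exists k, \int[nut]_x ((f x - F k x) ^+ 2) <= e / 4.
    move/cvgrPdist_le : cv => /(_ _ e4)[k _ /(_ k (leqnn k))]; rewrite sub0r normrN.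
    by move=> hk; exists k; rewrite (le_trans (ler_norm _)).
  have [_ /(_ _ e4)[L hL]] := IH k; exists L.
  have bL := bmeas_trigpoly L.
  have c1 := bmeasX (bmeasB bf (bF k)); have c2 := bmeasX (bmeasB (bF k) bL).
  apply: (@le_trans _ _ (\int[nut]_x (2 * (f x - F k x) ^+ 2
      + 2 * (F k x - trigpoly L x) ^+ 2))).
    apply: ler_bint; [exact: bmeasX (bmeasB _ _)|by apply: bmeasD; exact: bmeasZ|].
    by move=> x; have := sq2 (f x - F k x) (F k x - trigpoly L x); lra.
  rewrite bintD; [|exact: bmeasZ|exact: bmeasZ].
  by rewrite !bintZ//; lra.
Qed.

Definition centred f (x : T) : R := \int[K x]_y f y - \int[nut]_y f y.

Lemma bmeas_centred f : bmeas f -> bmeas (centred f).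
Proof. by move=> bf; apply: bmeasB; [exact: (bmeas_kernel bf).1|exact: bmeas_cst]. Qed.

(** Jensen under each [K x] and the invariance identity. This bound, with constant 1, controls the
    approximation error, for which the factor [rho] is not yet available. *)
Lemma centred_sqr_le f : bmeas f ->
  \int[nus]_x centred f x ^+ 2 <= \int[nut]_x f x ^+ 2.
Proof.
move=> bf; set m := \int[nut]_y f y.
have bm := bmeasB bf (bmeas_cst m).
apply: le_trans (bint_sqr_subr_le nut bf); rewrite -/m.
rewrite -(bmeas_kernel (bmeasX bm)).2; apply: ler_bint.
- exact: bmeasX (bmeas_centred bf).
- exact: (bmeas_kernel (bmeasX bm)).1.
- move=> x; apply: le_trans (bint_sqr_le (K x) bm).
  by rewrite bintB// ?bint_cst//; exact: bmeas_cst.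
Qed.

(** Young's inequality; a constant arbitrarily close to 1 in front of [a ^+ 2] is what preserves
    [rho] in the limit. *)
Lemma sqrD_le_weighted (a b e : R) : 0 < e ->
  (a + b) ^+ 2 <= (1 + e) * a ^+ 2 + (1 + e^-1) * b ^+ 2.
Proof.
move=> e0; have : 0 <= e^-1 * (e * a - b) ^+ 2 by rewrite mulr_ge0 ?sqr_ge0 ?invr_ge0 ?ltW.
rewrite (_ : e^-1 * _ = e * a ^+ 2 - 2 * a * b + e^-1 * b ^+ 2); first lra.
by field; rewrite gt_eqF.
Qed.

(** [C e] may blow up as [e] tends to 0, so [h] tends to 0 first with [e] fixed, and [e]
    afterwards. *)
Lemma ler_perturb (X Y : R) (C : R -> R) : 0 <= Y ->
  (forall e h : R, 0 < e -> 0 < h -> X <= (1 + e) ^+ 2 * Y + C e * h) -> X <= Y.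
Proof.
move=> Y0 hX.
have h1 e : 0 < e -> X <= (1 + e) ^+ 2 * Y.
  move=> e0; apply/ler_addgt0Pr => h h0.
  have c0 : 0 < 1 + `|C e| by rewrite ltr_pwDl.
  apply: (le_trans (hX e (h / (1 + `|C e|)) e0 _)); first by rewrite divr_gt0.
  rewrite lerD2l mulrA ler_pdivrMr// mulrC ler_pM2l//.
  by rewrite (le_trans (ler_norm _))// lerDr.
apply/ler_addgt0Pr => e e0; have y3 : 0 < 3 * Y + 1 by lra.
(* For [w <= 1] one has [(1 + w)^2 <= 1 + 3 w], and the second bound makes [3 w Y] at most [e]. *)
pose w := Num.min 1 (e / (3 * Y + 1)).
have w0 : 0 < w by rewrite lt_min ltr01 divr_gt0.
have w1 : w <= 1 by rewrite ge_min lexx.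
have we : w * (3 * Y + 1) <= e by rewrite -ler_pdivlMr// ge_min lexx orbT.
apply: (le_trans (h1 _ w0)).
have : w ^+ 2 <= w by rewrite expr2 ler_piMr// ltW.
move=> /(ler_wpM2r Y0); lra.
Qed.

Lemma centred_contraction f : bmeas f ->
  \int[nus]_x centred f x ^+ 2 <= rho * \int[nut]_x f x ^+ 2.
Proof.
move=> bf; have [mf [M fM]] := bf.
have [_ dense] := bclass_trigpoly_dense (bclass_measurable_bounded mf fM).
(* Young's inequality is used twice, under [nus] in [E1] and under [nut] in [E4]: hence the factor
   [(1 + e) ^+ 2]. [C e] collects the coefficients of the error [h]. *)
pose C e := (1 + e) * (rho * (1 + e^-1)) + (1 + e^-1).
apply: (@ler_perturb _ _ C).
  by rewrite mulr_ge0// Rintegral_ge0// => x _; exact: sqr_ge0.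
move=> e h e0 h0; have [L hL] := dense _ h0.
have bL := bmeas_trigpoly L; have bd := bmeasB bf bL.
have ei : 0 < e^-1 by rewrite invr_gt0.
have E1 : \int[nus]_x centred f x ^+ 2 <=
    (1 + e) * \int[nus]_x centred (trigpoly L) x ^+ 2 +
    (1 + e^-1) * \int[nus]_x centred (fun y => f y - trigpoly L y) x ^+ 2.
  have c1 := bmeasX (bmeas_centred bL); have c2 := bmeasX (bmeas_centred bd).
  rewrite -!bintZ// -bintD; [|exact: bmeasZ|exact: bmeasZ].
  apply: ler_bint; [exact: bmeasX (bmeas_centred _)|by apply: bmeasD; exact: bmeasZ|].
  move=> x; apply: le_trans (sqrD_le_weighted _ _ e0).
  rewrite le_eqVlt; apply/orP; left; apply/eqP; congr (_ ^+ 2).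
  by rewrite /centred !bintB//; ring.
have E2 : \int[nus]_x centred (trigpoly L) x ^+ 2 <= rho * \int[nut]_x trigpoly L x ^+ 2.
  have := transport_contraction L; congr (_ <= _); congr (Rintegral _ _ _).
  by apply/funext => x; rewrite /centred kernel_trigpoly.
have E3 := le_trans (centred_sqr_le bd) hL.
have E4 : \int[nut]_x trigpoly L x ^+ 2 <=
    (1 + e) * \int[nut]_x f x ^+ 2 + (1 + e^-1) * h.
  have c1 := bmeasX bf; have c2 := bmeasX bd.
  apply: (@le_trans _ _ (\int[nut]_x ((1 + e) * f x ^+ 2 +
      (1 + e^-1) * (f x - trigpoly L x) ^+ 2))).
    apply: ler_bint; [exact: bmeasX|by apply: bmeasD; exact: bmeasZ|].
    move=> x; have := sqrD_le_weighted (f x) (trigpoly L x - f x) e0.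
    by rewrite addrC subrK -(opprB (f x)) sqrrN.
  rewrite bintD; [|exact: bmeasZ|exact: bmeasZ].
  by rewrite !bintZ// lerD2l ler_wpM2l//; lra.
apply: (le_trans E1).
have p1 : 0 <= 1 + e by lra.
have p2 : 0 <= 1 + e^-1 by lra.
have F2 := ler_wpM2l p1 (le_trans E2 (ler_wpM2l rho_ge0 E4)).
have F3 := ler_wpM2l p2 E3.
by apply: (le_trans (lerD F2 F3)); rewrite /C; lra.
Qed.

End GaussianKernel.

(** * Extension to L^2 *)

Section L2Extension.
Context {d : measure_display} {T : measurableType d} {R : realType}.
Variables (nus nut : probability T R) (K : T -> probability T R) (rho : R).
Hypothesis rho_ge0 : 0 <= rho.
Hypothesis kernelP : forall f : T -> R, bmeas f ->
  bmeas (fun x => \int[K x]_y f y) /\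
  \int[nus]_x \int[K x]_y f y = \int[nut]_y f y.
Hypothesis contraction : forall f : T -> R, bmeas f ->
  \int[nus]_x ((\int[K x]_y f y - \int[nut]_y f y) ^+ 2)
  <= rho * \int[nut]_x f x ^+ 2.

Lemma ge0_kernelP (f : T -> R) : measurable_fun setT f -> (forall x, 0 <= f x) ->
  measurable_fun setT (fun x => \int[K x]_y (f y)%:E)%E /\
  (\int[nus]_x \int[K x]_y (f y)%:E = \int[nut]_y (f y)%:E)%E.
Proof.
move=> mf f0; pose fk (k : nat) y := Num.min (f y) k%:R.
have bfk k : bmeas (fk k).
  split; first by apply: measurable_minr => //; exact: measurable_cst.
  by exists k%:R => x; rewrite ger0_norm ?le_min ?f0 ?ler0n// ge_min lexx orbT.
have fk0 k y : (0 <= (fk k y)%:E)%E by rewrite lee_fin le_min f0 ler0n.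
have nd y : {homo (fun k => (fk k y)%:E) : a b / (a <= b)%N >-> (a <= b)%E}.
  move=> a b ab; rewrite lee_fin /fk le_min ge_min lexx /= ge_min.
  by rewrite orbC ler_nat ab.
have cf y : (fun k => (fk k y)%:E) @ \oo --> (f y)%:E.
  apply: cvg_near_cst; near=> k; rewrite /fk; congr (_%:E); apply/min_idPl.
  by apply: ltW; near: k; exact: nbhs_infty_gtr.
have cv (mu : probability T R) :
    (fun k => (\int[mu]_y fk k y)%:E) @ \oo --> (\int[mu]_y (f y)%:E)%E.
  rewrite (_ : (\int[mu]_y (f y)%:E = \int[mu]_y limn (fun k => (fk k y)%:E))%E); last first.
    by apply: eq_integral => y _; apply/esym/cvg_lim => //; exact: cf.
  under eq_fun do rewrite -bint_EFin//.
  apply: cvg_monotone_convergence => //.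
  by move=> k; apply/measurable_EFinP; exact: (bfk k).1.
split.
  apply: (@emeasurable_fun_cvg _ _ _ _ (fun k x => (\int[K x]_y fk k y)%:E)).
    by move=> k; apply/measurable_EFinP; exact: (kernelP (bfk k)).1.1.
  by move=> x _; exact: cv.
have c1 := cv nut.
rewrite (_ : (fun k => _) = (fun k => \int[nus]_x (\int[K x]_y fk k y)%:E)%E) in c1; last first.
  by apply/funext => k; have [b <-] := kernelP (bfk k); rewrite bint_EFin.
apply: cvg_unique c1 => //=.
rewrite (_ : (\int[nus]_x \int[K x]_y (f y)%:E =
  \int[nus]_x limn (fun k => (\int[K x]_y fk k y)%:E))%E); last first.
  by apply: eq_integral => x _; apply/esym/cvg_lim => //; exact: cv.
apply: cvg_monotone_convergence => //.
- by move=> k; apply/measurable_EFinP; exact: (kernelP (bfk k)).1.1.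
- by move=> k x _; rewrite lee_fin; apply: Rintegral_ge0 => y _; rewrite -lee_fin.
- move=> x _ a b ab; rewrite lee_fin; apply: ler_bint => // y.
  by rewrite -lee_fin; exact: nd.
Unshelve. all: by end_near. Qed.

(** The real integral is [fine] of the difference of the integrals of positive and negative parts,
    and [fine] is measurable, its default value at infinity included; so [f] may fail to be
    integrable under some [K x]. *)
Lemma measurable_kernel (f : T -> R) : measurable_fun setT f ->
  measurable_fun setT (fun x => \int[K x]_y f y).
Proof.
move=> mf; rewrite /Rintegral.
apply: (@measurableT_comp _ _ _ _ _ _ (@fine R)); first exact: fine_measurable.
under eq_fun do rewrite integralE.
apply: emeasurable_funB.
  rewrite funerpos; apply: (ge0_kernelP _ _).1; first exact: measurable_funrpos.
  by move=> x; rewrite /funrpos le_max lexx orbT.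
rewrite funerneg; apply: (ge0_kernelP _ _).1; first exact: measurable_funrneg.
by move=> x; rewrite /funrneg le_max lexx orbT.
Qed.

Variable phi : T -> R.
Hypothesis mphi : measurable_fun setT phi.

Let tr (k : nat) y := Num.max (- k%:R) (Num.min (phi y) k%:R).

Let tr_le k y : `|tr k y| <= `|phi y|.
Proof.
rewrite /tr; have k0 : 0 <= k%:R :> R by [].
have [p|p] := leP (phi y) k%:R; last first.
  rewrite max_r; last by lra.
  by rewrite ger0_norm// (le_trans (ltW p))// ler_norm.
have [q|q] := leP (- k%:R) (phi y) => //.
rewrite normrN ger0_norm// ler0_norm; lra.
Qed.

Let tr_bmeas k : bmeas (tr k).
Proof.
split.
  apply: measurable_maxr; first exact: measurable_cst.
  by apply: measurable_minr => //; exact: measurable_cst.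
exists k%:R => y; rewrite ler_norml /tr le_max lexx /= ge_max ge_min lexx orbT andbT.
by have : 0 <= k%:R :> R by []; lra.
Qed.

Let tr_cvg y : (fun k => tr k y) @ \oo --> phi y.
Proof.
apply: cvg_near_cst; near=> k.
have : `|phi y| < k%:R by near: k; exact: nbhs_infty_gtr.
by rewrite ltr_norml => /andP[a b]; rewrite /tr min_l ?max_r// ltW.
Unshelve. all: by end_near. Qed.

Let L2_integrable (mu : probability T R) : (\int[mu]_y (phi y ^+ 2)%:E < +oo)%E ->
  mu.-integrable setT (EFin \o phi).
Proof.
move=> fin.
have i2 : mu.-integrable setT (EFin \o (fun y => phi y ^+ 2)).
  apply/integrableP; split; first by apply/measurable_EFinP; exact: measurable_funX.
  by under eq_integral do rewrite /= ger0_norm ?sqr_ge0//.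
have i1 : mu.-integrable setT (EFin \o (fun=> 1)) by apply: bmeas_integrable; exact: bmeas_cst.
apply: (le_integrable _ _ _ (integrableD measurableT i1 i2)) => //.
  exact/measurable_EFinP.
move=> y _; rewrite /= lee_fin [leRHS]ger0_norm; last by have := sqr_ge0 (phi y); lra.
rewrite -(real_normK (num_real (phi y))).
by have := sqr_ge0 (`|phi y| - 1); have := normr_ge0 (phi y); lra.
Qed.

Let tr_int_cvg (mu : probability T R) : (\int[mu]_y (phi y ^+ 2)%:E < +oo)%E ->
  (fun k => \int[mu]_y tr k y) @ \oo --> \int[mu]_y phi y.
Proof.
move=> fin; have ip := L2_integrable fin.
have [|||||_ _ h] := @dominated_convergence _ _ _ mu setT measurableT
  (fun k => EFin \o tr k) (EFin \o phi) (EFin \o (fun y => `|phi y|)).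
- by move=> k; apply/measurable_EFinP; exact: (tr_bmeas k).1.
- exact/measurable_EFinP.
- by apply: aeW => x _ /=; apply/cvg_EFin; [exact: nearW|exact: tr_cvg].
- exact: integrable_norm.
- by apply: aeW => x k _ /=; rewrite lee_fin.
have E : (\int[mu]_y (phi y)%:E)%E = (\int[mu]_y phi y)%:E.
  by rewrite /Rintegral fineK//; exact: integrable_fin_num.
move: h; rewrite /= E => /fine_cvgP[_]; apply: cvg_trans.
by apply: near_eq_cvg; apply: nearW => k /=; rewrite bint_EFin.
Qed.

Let limn_einf_le (u : nat -> \bar R) (c : \bar R) : (forall k, u k <= c)%E ->
  (limn_einf u <= c)%E.
Proof.
move=> uc; rewrite limn_einf_lim; apply: lime_le; first exact: is_cvg_einfs.
apply: nearW => k; apply: le_trans (uc k); apply: ereal_inf_lbound.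
by exists k => //=.
Qed.

Lemma L2_kernel_contraction : (\int[nut]_y (phi y ^+ 2)%:E < +oo)%E ->
  (\int[nus]_x ((\int[K x]_y (phi y - \int[nut]_z phi z)) ^+ 2)%:E <=
   rho%:E * \int[nut]_y (phi y ^+ 2)%:E)%E.
Proof.
move=> fin; set M := \int[nut]_z phi z.
have m2 : measurable_fun setT (fun y => phi y ^+ 2) by exact: measurable_funX.
have [mh eh] := ge0_kernelP m2 (fun y => sqr_ge0 (phi y)).
pose h x := (\int[K x]_y (phi y ^+ 2)%:E)%E.
have h0 x : (0 <= h x)%E by apply: integral_ge0 => y _; rewrite lee_fin sqr_ge0.
have ih : nus.-integrable setT h.
  apply/integrableP; split => //.
  by under eq_integral do rewrite gee0_abs//; rewrite eh.
(* Off [N], [phi] is square integrable and hence integrable under [K x], so the truncated integrals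
   converge. On [N] the real integral may be a mere default value, but [N] is null because [h] has
   finite integral under [nus]. *)
pose N := [set x | h x = +oo%E].
have mN : measurable N.
  by have := mh measurableT _ (emeasurable_set1 +oo%E); rewrite setTI.
have N0 : nus N = 0%E.
  apply/negligibleP => //; have := integrable_ae measurableT ih.
  by apply: negligibleS => x /= -> /(_ Logic.I).
have mu_ : measurable_fun setT (fun x => ((\int[K x]_y (phi y - M)) ^+ 2)%:E).
  apply/measurable_EFinP; apply: measurable_funX; apply: measurable_kernel.
  by apply: measurable_funB => //; exact: measurable_cst.
rewrite (ge0_negligible_integral mN)//; last by move=> x _; rewrite lee_fin sqr_ge0.
rewrite setTD.
pose u k x := ((\int[K x]_y tr k y - \int[nut]_y tr k y) ^+ 2)%:E.
have bu k : bmeas (fun x => (\int[K x]_y tr k y - \int[nut]_y tr k y) ^+ 2).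
  by apply: bmeasX; apply: bmeasB; [exact: (kernelP (tr_bmeas k)).1|exact: bmeas_cst].
have uE x : (~` N) x -> ((\int[K x]_y (phi y - M)) ^+ 2)%:E = limn_einf (u ^~ x).
  move=> Nx; have hx : (h x < +oo)%E by rewrite ltey; apply/eqP.
  have c : (u ^~ x) @ \oo --> ((\int[K x]_y (phi y - M)) ^+ 2)%:E.
    apply/cvg_EFin; first exact: nearW.
    rewrite RintegralB//; [|exact: L2_integrable|by apply: bmeas_integrable; exact: bmeas_cst].
    rewrite bint_cst expr2 /comp /=; under eq_fun do rewrite expr2.
    by apply: cvgM; apply: cvgB; exact: tr_int_cvg.
  by rewrite is_cvg_limn_einfE; [apply/esym/cvg_lim|apply/cvg_ex; eexists; exact: c].
rewrite (eq_integral (fun x => limn_einf (u ^~ x))); last first.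
  by move=> x; rewrite inE => Nx; exact: uE.
have mu_k k : measurable_fun setT (u k) by apply/measurable_EFinP; exact: (bu k).1.
have u0 k x : (0 <= u k x)%E by rewrite lee_fin sqr_ge0.
(* Fatou asks only for a bound on each truncated integral; [contraction] supplies it, as [tr k] is
   dominated by [phi]. *)
apply: (le_trans (fatou _ _ _ _)).
- exact: measurableC.
- by move=> k; apply: measurable_funTS; exact: mu_k.
- by move=> k x _.
apply: limn_einf_le => k.
apply: (@le_trans _ _ (\int[nus]_x u k x)%E).
  by apply: ge0_subset_integral => //; exact: measurableC.
rewrite bint_EFin//.
apply: (@le_trans _ _ (rho * \int[nut]_x tr k x ^+ 2)%:E).
  by rewrite lee_fin; exact: contraction (tr_bmeas k).
rewrite EFinM lee_wpmul2l ?lee_fin// -bint_EFin; last exact: bmeasX.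
apply: ge0_le_integral => //.
- by move=> x _; rewrite lee_fin sqr_ge0.
- by apply/measurable_EFinP; exact: (bmeasX (tr_bmeas k)).1.
- exact/measurable_EFinP.
- move=> x _; rewrite lee_fin -(real_normK (num_real (tr k x))).
  by rewrite -(real_normK (num_real (phi x))) lerXn2r ?nnegrE.
Qed.

End L2Extension.

Section L2Norm.
Context {d : measure_display} {T : measurableType d} {R : realType}.

Lemma Lnorm2E (mu : probability T R) (f : T -> R) :
  ('N[mu]_2%:E[EFin \o f] = (\int[mu]_x (f x ^+ 2)%:E) `^ 2^-1)%E.
Proof.
rewrite unlock /=; congr (_ `^ _)%E; apply: eq_integral => x _.
by rewrite powR_mulrn// real_normK// num_real.
Qed.

Lemma Lnorm2_lty (mu : probability T R) (f : T -> R) :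
  ('N[mu]_2%:E[EFin \o f] < +oo -> \int[mu]_x (f x ^+ 2)%:E < +oo)%E.
Proof.
rewrite Lnorm2E => h; rewrite ltey; apply/eqP => E; move: h; rewrite E.
by rewrite poweRyr// invr_neq0.
Qed.

Lemma Lnorm2_le (mu nu : probability T R) (f g : T -> R) (c : R) :
  (\int[mu]_x (f x ^+ 2)%:E <= (expR (2 * c))%:E * \int[nu]_x (g x ^+ 2)%:E)%E ->
  ('N[mu]_2%:E[EFin \o f] <= (expR c)%:E * 'N[nu]_2%:E[EFin \o g])%E.
Proof.
move=> h; rewrite !Lnorm2E.
have i0 (m : probability T R) (u : T -> R) : (0 <= \int[m]_x (u x ^+ 2)%:E)%E.
  by apply: integral_ge0 => x _; rewrite lee_fin sqr_ge0.
have -> : ((expR c)%:E = (expR (2 * c))%:E `^ 2^-1)%E.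
  by rewrite poweR_EFin -expRM mulrAC divff// mul1r.
rewrite -poweRM ?lee_fin ?expR_ge0//.
by apply: gt0_ler_poweR => //; rewrite in_itv /= leey andbT// mule_ge0// lee_fin expR_ge0.
Qed.

End L2Norm.

(** * Linear differential equations *)

Section OperatorNorm.
Context {R : realType} {n : nat}.
Implicit Types (u v : 'cV[R]_n) (M : 'M[R]_n).

Lemma enorm_ge0 v : 0 <= enorm v.
Proof. exact: sqrtr_ge0. Qed.

Lemma sqr_enorm v : enorm v ^+ 2 = dotp v v.
Proof. by rewrite sqr_sqrtr// dotp_ge0. Qed.

Lemma enormZ a v : enorm (a *: v) = `|a| * enorm v.
Proof. by rewrite /enorm dotpZl dotpZr mulrA -expr2 sqrtrM ?sqr_ge0// sqrtr_sqr. Qed.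

Lemma dotp_le_enorm u v : dotp u v <= enorm u * enorm v.
Proof.
have [v0|v0] := eqVneq (dotp v v) 0.
  by rewrite (dotp_eq0 v0) dotpC dotp0l mulr_ge0// enorm_ge0.
have vp : 0 < dotp v v by rewrite lt_neqAle eq_sym v0 dotp_ge0.
have : 0 <= dotp v v * (dotp u u * dotp v v - dotp u v ^+ 2).
  have := dotp_ge0 (dotp v v *: u - dotp u v *: v).
  rewrite !dotpDl !dotpDr !dotpNl !dotpNr !dotpZl !dotpZr (dotpC v u).
  by congr (_ <= _); ring.
rewrite pmulr_rge0// subr_ge0 -!sqr_enorm -exprMn => h.
apply: (le_trans (ler_norm _)); rewrite -(@ler_pXn2r _ 2) ?nnegrE ?mulr_ge0 ?enorm_ge0//.
by rewrite real_normK ?num_real.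
Qed.

Lemma normr_dotp_le u v : `|dotp u v| <= enorm u * enorm v.
Proof.
rewrite ler_norml dotp_le_enorm andbT lerNl -dotpNl.
by have := dotp_le_enorm (- u) v; rewrite -scaleN1r enormZ normrN1 mul1r.
Qed.

(** [opnorm] is a real [sup], informative only over a bounded set; Cauchy-Schwarz on each row gives
    the Frobenius norm as a bound. *)
Lemma opnorm_has_sup M :
  has_sup [set enorm (M *m v) | v in [set v | enorm v <= 1]].
Proof.
split; first by exists (enorm (M *m 0)), 0 => //=; rewrite /enorm dotp0l sqrtr0.
exists (Num.sqrt (\sum_i dotp (row i M)^T (row i M)^T)) => _ [v /= v1 <-].
rewrite ler_sqrt; last by apply: sumr_ge0 => i _; exact: dotp_ge0.
apply: ler_sum => i _.
have -> : (M *m v) i 0 = dotp (row i M)^T v.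
  by rewrite mxE; apply: eq_bigr => j _; rewrite !mxE.
rewrite -expr2 -real_normK ?num_real//.
apply: (@le_trans _ _ ((enorm (row i M)^T * enorm v) ^+ 2)).
  by rewrite lerXn2r ?nnegrE ?mulr_ge0 ?enorm_ge0//; exact: normr_dotp_le.
rewrite exprMn sqr_enorm -[leRHS]mulr1 ler_wpM2l ?dotp_ge0//.
by rewrite exprn_ile1// enorm_ge0.
Qed.

Lemma opnorm_ge0 M : 0 <= opnorm M.
Proof.
apply: (le_trans (enorm_ge0 (M *m 0))); apply: (sup_upper_bound (opnorm_has_sup M)).
by exists 0 => //=; rewrite /enorm dotp0l sqrtr0.
Qed.

Lemma enorm_mulmx_le M v : enorm (M *m v) <= opnorm M * enorm v.
Proof.
have [v0|v0] := eqVneq (enorm v) 0.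
  have -> : v = 0 by apply: dotp_eq0; rewrite -sqr_enorm v0 expr0n.
  by rewrite mulmx0 /enorm dotp0l sqrtr0 mulr0.
have vp : 0 < enorm v by rewrite lt_neqAle eq_sym v0 enorm_ge0.
rewrite -ler_pdivrMr// mulrC -[_^-1]ger0_norm ?invr_ge0 ?enorm_ge0//.
rewrite -enormZ scalemxAr; apply: (sup_upper_bound (opnorm_has_sup M)).
exists ((enorm v)^-1 *: v) => //=.
by rewrite enormZ ger0_norm ?invr_ge0 ?enorm_ge0// mulVf.
Qed.

(** [|M^T v|^2 = <M M^T v, v> <= opnorm M |M^T v| |v|], and one factor [|M^T v|] cancels. *)
Lemma enorm_trmulmx_le M v : enorm (M^T *m v) <= opnorm M * enorm v.
Proof.
have [->|v0] := eqVneq (enorm (M^T *m v)) 0; first by rewrite mulr_ge0 ?opnorm_ge0 ?enorm_ge0.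
have vp : 0 < enorm (M^T *m v) by rewrite lt_neqAle eq_sym v0 enorm_ge0.
rewrite -(ler_pM2r vp) -expr2 sqr_enorm -dotp_tr.
apply: (le_trans (dotp_le_enorm _ _)).
by rewrite mulrAC ler_wpM2r ?enorm_ge0//; exact: enorm_mulmx_le.
Qed.

Lemma enorm_delta (i : 'I_n) : enorm (delta_mx i 0 : 'cV[R]_n) = 1.
Proof.
rewrite /enorm /dotp (bigD1 i)//= big1 ?addr0 ?mxE ?eqxx ?mulr1 ?sqrtr1//.
by move=> j jn; rewrite !mxE (negbTE jn) mul0r.
Qed.

Lemma opnorm1 : (0 < n)%N -> opnorm (1%:M : 'M[R]_n) >= 1.
Proof.
move=> n0; have := enorm_mulmx_le 1%:M (delta_mx (Ordinal n0) 0 : 'cV[R]_n).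
by rewrite mul1mx enorm_delta mulr1.
Qed.

(** The lower bound is given for [B], while the quadratic forms of the covariances see [B^T]. It
    makes [M] invertible; with [v = M y], [|v|^2 = <y, M^T v> <= |y| |M^T v|] and
    [mu |y| <= |v|]. *)
Lemma enorm_lower_tr M (mu : R) : 0 < mu -> (forall v, mu * enorm v <= enorm (M *m v)) ->
  forall v, mu * enorm v <= enorm (M^T *m v).
Proof.
move=> mu0 hM v.
have uM : M \in unitmx.
  rewrite -unitmx_tr -row_free_unit -kermx_eq0; apply/eqP/row_matrixP => i.
  have := sub_kermxP (row_sub i (kermx M^T)) => h.
  rewrite row0; apply: trmx_inj; rewrite trmx0; apply: dotp_eq0; rewrite -sqr_enorm.
  have e : M *m (row i (kermx M^T))^T = 0 by rewrite -[M *m _]trmxK trmx_mul trmxK h trmx0.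
  have := hM (row i (kermx M^T))^T; rewrite e /enorm dotp0l sqrtr0 pmulr_rle0//.
  by move=> le0; have := enorm_ge0 (row i (kermx M^T))^T; rewrite /enorm => ge0;
    rewrite (_ : Num.sqrt _ = 0) ?expr0n//; apply/eqP; rewrite eq_le le0 ge0.
pose y := invmx M *m v; have vE : v = M *m y by rewrite mulKVmx.
have [->|v0] := eqVneq (enorm v) 0; first by rewrite mulr0 enorm_ge0.
have vp : 0 < enorm v by rewrite lt_neqAle eq_sym v0 enorm_ge0.
rewrite -(ler_pM2r vp) -mulrA -expr2 sqr_enorm {1}vE dotp_tr.
apply: (@le_trans _ _ (mu * (enorm y * enorm (M^T *m v)))).
  by rewrite ler_pM2l//; exact: dotp_le_enorm.
rewrite mulrA mulrC ler_wpM2l ?enorm_ge0//.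
by have := hM y; rewrite -vE.
Qed.

End OperatorNorm.

Section LinearODE.
Context {R : realType} {n : nat}.

Lemma ndecr_is_derive (f df : R -> R) (a b : R) : a <= b ->
  (forall x, a <= x <= b -> is_derive x (1 : R) f (df x)) ->
  (forall x, a <= x <= b -> 0 <= df x) -> f a <= f b.
Proof.
rewrite le_eqVlt => /predU1P[->//|ab] fd df0.
have [||c cab e] := @MVT R f df a b ab.
- by move=> x; rewrite in_itv /= => /andP[ax xb]; apply: fd; rewrite !ltW.
- apply: derivable_within_continuous => x; rewrite in_itv /= => xab.
  exact: (@ex_derive _ _ _ _ _ _ _ (fd x xab)).
- rewrite -subr_ge0 e; move: cab; rewrite in_itv /= => /andP[ac cb].
  by rewrite mulr_ge0 ?subr_ge0 ?(ltW ab)// df0// !ltW.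
Qed.

Lemma is_derive_expRM (f : R -> R) (df k x : R) : is_derive x (1 : R) f df ->
  is_derive x (1 : R) (fun y => expR (k * y) * f y) (expR (k * x) * (k * f x + df)).
Proof.
move=> fd.
have h1 : is_derive x (1 : R) (fun y => k * y) k.
  have := @is_deriveZ _ _ _ id k x (1 : R) 1 (is_derive_id _ _).
  by rewrite /GRing.scale /= mulr1.
have h2 := @is_derive1_comp _ (@expR R) (fun y => k * y) x _ _ (is_derive_expR _) h1.
have := @is_deriveM _ _ (@expR R \o (fun y => k * y)) f x 1 _ _ h2 fd.
by move=> h; apply: (is_derive_eq h); rewrite /= /GRing.scale /=; ring.
Qed.

Lemma gronwall_ndecr (f df : R -> R) (k a b : R) : a <= b ->
  (forall x, a <= x <= b -> is_derive x (1 : R) f (df x)) ->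
  (forall x, a <= x <= b -> k * f x <= df x) -> expR (k * (b - a)) * f a <= f b.
Proof.
move=> ab fd h.
have := @ndecr_is_derive (fun y => expR (- k * y) * f y)
  (fun x => expR (- k * x) * (- k * f x + df x)) a b ab.
move=> /(_ (fun x xab => is_derive_expRM _ (fd x xab))) H.
have {H}: expR (- k * a) * f a <= expR (- k * b) * f b.
  apply: H => x xab; rewrite mulr_ge0 ?expR_ge0//; have := h x xab; lra.
move=> /(ler_wpM2l (expR_ge0 (k * b))); rewrite !mulrA -!expRD.
rewrite (_ : k * b + - k * b = 0) ?expR0 ?mul1r; last by ring.
by rewrite (_ : k * b + - k * a = k * (b - a)); last by ring.
Qed.

(** Both directions of time are covered: after [r] the growth estimate is applied to [- p] with rate
    [k], before [r] to [p] with rate [- k]. *)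
Lemma gronwall_eq0 (p dp : R -> R) (k r : R) :
  (forall x, is_derive x (1 : R) p (dp x)) -> (forall x, 0 <= p x) ->
  (forall x, `|dp x| <= k * p x) -> p r = 0 -> forall t, p t = 0.
Proof.
move=> pd p0 hp pr t; apply/eqP; rewrite eq_le p0 andbT.
have [rt|tr] := leP r t.
  have := @gronwall_ndecr (\- p) (fun x => - dp x) k r t rt.
  move=> /(_ (fun x _ => is_deriveN (pd x))) /=; rewrite pr oppr0 mulr0 oppr_ge0; apply.
  by move=> x _; have := hp x; rewrite ler_norml mulrN => /andP[_]; rewrite lerN2.
have := @gronwall_ndecr p dp (- k) t r (ltW tr) (fun x _ => pd x).
rewrite pr pmulr_rle0 ?expR_gt0//; apply => x _.
by have := hp x; rewrite ler_norml mulNr => /andP[].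
Qed.

Lemma is_derive_sqnorm (y : R -> 'cV[R]_n) (dy : 'cV[R]_n) (t : R) :
  (forall i, is_derive t (1 : R) (fun x => y x i 0) (dy i 0)) ->
  is_derive t (1 : R) (fun x => dotp (y x) (y x)) (2 * dotp (y t) dy).
Proof.
move=> yd.
have := @is_derive_sum _ _ _ n (fun i => (fun x => y x i 0) * (fun x => y x i 0)) t 1
  (fun i => y t i 0 *: dy i 0 + y t i 0 *: dy i 0)
  (fun i => is_deriveM (yd i) (yd i)).
rewrite (_ : \sum_(i < n) _ = (fun x => dotp (y x) (y x))); last first.
  by apply/funext => x; rewrite fct_sumE; apply: eq_bigr.
move=> h; apply: (is_derive_eq h); rewrite mulr_sumr; apply: eq_bigr => i _.
by rewrite /GRing.scale /=; ring.
Qed.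

Lemma continuous_sum_fun (I : Type) (l : seq I) (F : I -> R -> R) :
  (forall i, continuous (F i)) -> continuous (fun x => \sum_(i <- l) F i x).
Proof.
move=> cF; elim: l => [|i l IH] x.
  by under eq_fun do rewrite big_nil; exact: cvg_cst.
by under eq_fun do rewrite big_cons; apply: cvgD; [exact: cF|exact: IH].
Qed.

Lemma continuous_prod_fun (I : Type) (l : seq I) (F : I -> R -> R) :
  (forall i, continuous (F i)) -> continuous (fun x => \prod_(i <- l) F i x).
Proof.
move=> cF; elim: l => [|i l IH] x.
  by under eq_fun do rewrite big_nil; exact: cvg_cst.
by under eq_fun do rewrite big_cons; apply: cvgM; [exact: cF|exact: IH].
Qed.

Lemma continuous_det m (M : R -> 'M[R]_m) :
  (forall i j, continuous (fun x => M x i j)) -> continuous (fun x => \det (M x)).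
Proof.
move=> cM; rewrite /determinant; apply: continuous_sum_fun => s x.
apply: cvgMl_tmp.
apply: (@continuous_prod_fun _ (index_enum _)
  (fun i x => M x i (perm.fun_of_perm s i))) => i.
exact: cM.
Qed.

Variable A : R -> 'M[R]_n.
Hypothesis A_bnd : exists K : R, forall t, opnorm (A t) <= K.

Lemma linear_ode_eq0 (y : R -> 'cV[R]_n) (r : R) :
  (forall t i, is_derive t (1 : R) (fun x => y x i 0) ((A t *m y t) i 0)) ->
  y r = 0 -> forall t, y t = 0.
Proof.
have [K AK] := A_bnd; move=> yd yr t; apply: dotp_eq0.
apply: (@gronwall_eq0 (fun x => dotp (y x) (y x)) (fun x => 2 * dotp (y x) (A x *m y x))
  (2 * K) r).
- by move=> x; exact: is_derive_sqnorm.
- by move=> x; exact: dotp_ge0.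
- move=> x; rewrite normrM ger0_norm// -mulrA ler_pM2l//.
  apply: (le_trans (normr_dotp_le _ _)); rewrite -sqr_enorm expr2 mulrA mulrC.
  rewrite ler_wpM2r ?enorm_ge0//; apply: (le_trans (enorm_mulmx_le _ _)).
  by rewrite ler_wpM2r ?enorm_ge0.
- by rewrite yr dotp0l.
Qed.

Variable U : R -> R -> 'M[R]_n.
Hypothesis U_init : forall s, U s s = 1%:M.
Hypothesis U_ode : forall s t : R,
  is_derive t (1 : R) (fun tau => U tau s) (A t *m U t s).

Lemma is_derive_evol_entry s t i j :
  is_derive t (1 : R) (fun tau => U tau s i j) ((A t *m U t s) i j).
Proof.
have [d e] := U_ode s t; have dij := (derivable_mxP _ _ _).1 d.
apply: DeriveDef; first exact: dij.
by have := derive_mx d; rewrite e => /matrixP/(_ i j) ->; rewrite mxE.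
Qed.

(** In the first variable, corresponding columns of the two sides solve the same linear equation and
    agree at time [r]. Uniqueness also holds backwards, so the three times may come in any order. *)
Lemma evol_cocycle t r s : U t r *m U r s = U t s.
Proof.
apply/matrixP => i j; apply/eqP; rewrite -subr_eq0.
pose y x : 'cV[R]_n := col j (U x r *m U r s - U x s).
have yt : y t = 0.
  apply: (@linear_ode_eq0 y r) => [x k|]; last first.
    by rewrite /y U_init mul1mx subrr; apply/colP => k; rewrite !mxE.
  have h1 := @is_derive_sum _ _ _ n (fun l => U r s l j \*: (fun z => U z r k l)) x 1
    (fun l => U r s l j *: (A x *m U x r) k l)
    (fun l => is_deriveZ _ (is_derive_evol_entry r x k l)).
  have := is_deriveB h1 (is_derive_evol_entry s x k j).
  rewrite (_ : \sum_(l < n) _ - _ = (fun z => y z k 0)); last first.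
    apply/funext => z; rewrite /y !mxE /=; congr (_ - _); rewrite fct_sumE.
    by apply: eq_bigr => l _; rewrite /= /GRing.scale /= mulrC.
  move=> h; apply: (is_derive_eq h).
  have -> : (A x *m y x) k 0 = (A x *m U x r *m U r s) k j - (A x *m U x s) k j.
    by rewrite /y colE mulmxA -colE mulmxBr mulmxA !mxE.
  congr (_ - _); rewrite [RHS]mxE.
  by apply: eq_bigr => l _; rewrite /GRing.scale /= mulrC.
by move/colP : yt => /(_ i); rewrite !mxE => ->.
Qed.

Lemma evol_invE t r : U t r = invmx (U r t).
Proof.
have h : U t r *m U r t = 1%:M by rewrite evol_cocycle U_init.
have [_ ur] := mulmx1_unit h.
by rewrite -[LHS]mulmx1 -(mulmxV ur) mulmxA h mul1mx.
Qed.

Lemma continuous_evol_entry s i j : continuous (fun t => U t s i j).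
Proof.
move=> t; apply/differentiable_continuous/derivable1_diffP.
exact: (@ex_derive _ _ _ _ _ _ _ (is_derive_evol_entry s t i j)).
Qed.

(** The equation for [U] concerns the first variable only. As [U t r] is the inverse of [U r t],
    Cramer's rule transfers continuity to the second. *)
Lemma continuous_evol_entry_r t i j : continuous (fun r => U t r i j).
Proof.
have E r : U t r i j = (\det (U r t))^-1 * cofactor (U r t) j i.
  rewrite evol_invE /invmx ifT; last first.
    have h : U t r *m U r t = 1%:M by rewrite evol_cocycle U_init.
    by have [] := mulmx1_unit h.
  by rewrite !mxE.
under eq_fun do rewrite E; move=> r.
have dn0 : \det (U r t) != 0.
  have h : U t r *m U r t = 1%:M by rewrite evol_cocycle U_init.
  by have [_] := mulmx1_unit h; rewrite unitmxE unitfE.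
apply: cvgM.
  apply: cvgV => //; apply: continuous_det => k l; exact: continuous_evol_entry.
apply: cvgMl_tmp; apply: (@continuous_det _ (fun r => row' j (col' i (U r t)))) => k l.
by under eq_fun do rewrite !mxE; exact: continuous_evol_entry.
Qed.

End LinearODE.

(** * Integrals over half-lines *)

Section HalfLineIntegrals.
Context {R : realType}.
Local Notation leb := (@lebesgue_measure R).

Lemma integral_expR_halfline (a x : R) : 0 < a ->
  (\int[leb]_(r in `]-oo, x]) (expR (a * (r - x)))%:E)%E = (a^-1)%:E.
Proof.
move=> a0.
have dE (k c y : R) : is_derive y (1 : R) (fun r => expR (k * r + c)) (k * expR (k * y + c)).
  have h := @is_derive_expRM R (fun=> expR c) 0 k y (is_derive_cst _ _ _).
  rewrite (_ : (fun r => _) = (fun r => expR (k * r) * expR c)).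
    by apply: (is_derive_eq h); rewrite addr0 expRD; ring.
  by apply/funext => r; rewrite expRD.
have cE (k c : R) : continuous (fun r => expR (k * r + c)).
  move=> y; apply/differentiable_continuous/derivable1_diffP.
  exact: (@ex_derive _ _ _ _ _ _ _ (dE k c y)).
rewrite (_ : (fun r => _) = (fun r => (expR (a * r + - (a * x)))%:E)); last first.
  by apply/funext => r; rewrite mulrBr.
(* Reflection in 0 produces a half-line towards [+oo], on which the improper fundamental theorem of
   calculus applies. *)
rewrite -[x in LHS]opprK ge0_integration_by_substitutionNy; first last.
- by move=> y _; exact: expR_ge0.
- by apply: continuous_subspaceT; exact: cE.
rewrite (_ : (fun r => _) = (fun r => (expR (- a * r + - (a * x)))%:E)); last first.
  by apply/funext => r /=; rewrite mulrN mulNr opprK.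
rewrite (@ge0_continuous_FTC2y _ _ (fun r => - a^-1 * expR (- a * r + - (a * x))) _ 0).
- rewrite -EFinB sub0r mulNr opprK (_ : - a * - x + _ = 0) ?expR0 ?mulr1//; ring.
- by move=> y _; exact: expR_ge0.
- by apply: continuous_subspaceT; exact: cE.
- rewrite -[X in _ --> X](mulr0 (- a^-1)); apply: cvgMl_tmp.
  rewrite (_ : (fun r => _) = (fun r => expR (- (a * r + a * x)))); last first.
    by apply/funext => r; rewrite mulNr opprD.
  apply: (cvg_comp _ _ _ (@cvgr_expR R)).
  apply/cvgryPge => M; near=> r.
  by rewrite -lerBlDr -ler_pdivrMl//; near: r; apply: nbhs_pinfty_ge; exact: num_real.
- move=> y _; exact: (@ex_derive _ _ _ _ _ _ _ (is_deriveZ (- a^-1) (dE (- a) (- (a * x)) y))).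
- apply: cvg_at_right_filter; apply: cvgMl_tmp; exact: cE.
- move=> y _; rewrite derive1E.
  have := @derive_val _ _ _ _ _ _ _ (is_deriveZ (- a^-1) (dE (- a) (- (a * x)) y)).
  rewrite /GRing.scale /= => ->.
  by rewrite mulrA mulrNN mulVf ?mul1r// gt_eqF.
Unshelve. all: by end_near. Qed.

Lemma integrable_expR_halfline (a x : R) : 0 < a ->
  leb.-integrable `]-oo, x] (EFin \o (fun r => expR (a * (r - x)))).
Proof.
move=> a0; apply/integrableP; split.
  apply/measurable_EFinP; apply: measurable_funTS; apply: continuous_measurable_fun => y.
  apply: continuous_comp; last exact: continuous_expR.
  by apply: cvgMl_tmp; apply: cvgB; [exact: cvg_id|exact: cvg_cst].
under eq_integral do rewrite /= ger0_norm ?expR_ge0//.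
by rewrite integral_expR_halfline// ltry.
Qed.

Lemma integrable_expR_bound (h : R -> R) (c a x : R) : 0 < a -> continuous h ->
  (forall r, r <= x -> `|h r| <= c * expR (a * (r - x))) ->
  leb.-integrable `]-oo, x] (EFin \o h).
Proof.
move=> a0 ch hb.
have ic : leb.-integrable `]-oo, x] (EFin \o (fun r => c * expR (a * (r - x)))).
  rewrite (_ : EFin \o _ = (fun r => c%:E * (expR (a * (r - x)))%:E)%E)//.
  by apply: integrableZl => //; exact: integrable_expR_halfline.
apply: (le_integrable _ _ _ ic) => //.
  by apply/measurable_EFinP; apply: measurable_funTS; exact: continuous_measurable_fun.
move=> r; rewrite /= in_itv /= => rx; rewrite lee_fin.
by apply: (le_trans (hb r rx)); exact: ler_norm.
Qed.

Lemma Rintegral_sum_seq (D : set R) (mD : measurable D) (I : Type) (s : seq I)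
    (G : I -> R -> R) : (forall i, leb.-integrable D (EFin \o G i)) ->
  leb.-integrable D (EFin \o (fun r => \sum_(i <- s) G i r)) /\
  \int[leb]_(r in D) (\sum_(i <- s) G i r) = \sum_(i <- s) \int[leb]_(r in D) G i r.
Proof.
move=> iG; elim: s => [|i s [i1 e1]].
  rewrite big_nil; under eq_fun do rewrite big_nil; split; last first.
    by rewrite /Rintegral integral0.
  by rewrite (_ : EFin \o _ = cst 0%E)//; exact: integrable0.
rewrite big_cons -e1 -RintegralD//; under eq_fun do rewrite big_cons; split => //.
by rewrite (_ : EFin \o _ = ((EFin \o G i) \+ (EFin \o (fun r => (\sum_(j <- s) G j r)%R)))%E)//;
  exact: integrableD.
Qed.

Context {n : nat}.

(** Congruences, quadratic forms and the pairing in [dual_psd] are all linear in the entries, so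
    their exchanges with the integral are instances of this one. *)
Lemma Rintegral_form (D : set R) (mD : measurable D) (F : R -> 'M[R]_n) (L : 'I_n -> 'I_n -> R) :
  (forall i j, leb.-integrable D (EFin \o (fun r => F r i j))) ->
  leb.-integrable D (EFin \o (fun r => \sum_i \sum_j L i j * F r i j)) /\
  \int[leb]_(r in D) (\sum_i \sum_j L i j * F r i j) = \sum_i \sum_j L i j * mint D F i j.
Proof.
move=> iF.
have i0 i j : leb.-integrable D (EFin \o (fun r => L i j * F r i j)).
  rewrite (_ : EFin \o _ = (fun r => (L i j)%:E * (F r i j)%:E)%E)//.
  by apply: integrableZl => //; exact: iF.
have h i := Rintegral_sum_seq mD (index_enum _) (i0 i).
have [i1 e1] := Rintegral_sum_seq mD (index_enum _) (fun i => (h i).1).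
split => //; rewrite e1; apply: eq_bigr => i _; rewrite (h i).2; apply: eq_bigr => j _.
by rewrite RintegralZl// mxE.
Qed.

Lemma mulmx_conj_entry (P X : 'M[R]_n) i j :
  (P *m X *m P^T) i j = \sum_k \sum_l (P i k * P j l) * X k l.
Proof.
rewrite mxE; under eq_bigr do rewrite !mxE mulr_suml.
rewrite exchange_big /=; apply: eq_bigr => k _; apply: eq_bigr => l _; ring.
Qed.

Lemma mint_conj (D : set R) (mD : measurable D) (F : R -> 'M[R]_n) (P : 'M[R]_n) :
  (forall i j, leb.-integrable D (EFin \o (fun r => F r i j))) ->
  (forall i j, leb.-integrable D (EFin \o (fun r => (P *m F r *m P^T) i j))) /\
  mint D (fun r => P *m F r *m P^T) = P *m mint D F *m P^T.
Proof.
move=> iF; split => [i j|].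
  under eq_fun do rewrite mulmx_conj_entry.
  exact: (Rintegral_form mD (fun k l => P i k * P j l) iF).1.
apply/matrixP => i j; rewrite mulmx_conj_entry mxE.
under eq_Rintegral do rewrite mulmx_conj_entry.
exact: (Rintegral_form mD (fun k l => P i k * P j l) iF).2.
Qed.

Lemma dotp_mint (D : set R) (mD : measurable D) (F : R -> 'M[R]_n) (u v : 'cV[R]_n) :
  (forall i j, leb.-integrable D (EFin \o (fun r => F r i j))) ->
  leb.-integrable D (EFin \o (fun r => dotp (F r *m u) v)) /\
  dotp (mint D F *m u) v = \int[leb]_(r in D) dotp (F r *m u) v.
Proof.
move=> iF.
have E X : dotp (X *m u) v = \sum_i \sum_j (u j 0 * v i 0) * X i j.
  by rewrite dotp_sum_entries; do 2 apply: eq_bigr => ? _; ring.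
rewrite E; under eq_fun do rewrite E.
by have [? ->] := Rintegral_form mD (fun i j => u j 0 * v i 0) iF.
Qed.

(** Paired with [G r (G r)^T], the test matrix [L] gives the sum of [<L g, g>] over the columns [g]
    of [G r], so the integrand is nonnegative pointwise. *)
Lemma dual_psd_mint (D : set R) (mD : measurable D) (F G : R -> 'M[R]_n) :
  (forall i j, leb.-integrable D (EFin \o (fun r => F r i j))) ->
  (forall r, F r = G r *m (G r)^T) -> dual_psd (mint D F).
Proof.
move=> iF FE L hL; rewrite -(Rintegral_form mD L iF).2.
apply: Rintegral_ge0 => r _.
have -> : \sum_i \sum_j L i j * F r i j = \sum_k dotp (L *m col k (G r)) (col k (G r)).
  under [RHS]eq_bigr do rewrite dotp_sum_entries.
  rewrite [RHS]exchange_big /=; apply: eq_bigr => i _.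
  rewrite [RHS]exchange_big /=; apply: eq_bigr => j _.
  by rewrite FE mxE mulr_sumr; apply: eq_bigr => k _; rewrite !mxE; ring.
by apply: sumr_ge0 => k _; exact: hL.
Qed.

Lemma trmx_mint (D : set R) (F : R -> 'M[R]_n) :
  (forall r, (F r)^T = F r) -> (mint D F)^T = mint D F.
Proof.
move=> sF; apply/matrixP => i j; rewrite !mxE; apply: eq_Rintegral => r _.
by rewrite -[in LHS]sF mxE.
Qed.

Lemma dual_psd_covariance (Q : 'M[R]_n) : Q^T = Q -> dual_psd Q -> covariance_matrix Q.
Proof.
move=> sQ dQ; split => // v.
have := dQ (\matrix_(i, j) (v i 0 * v j 0)).
rewrite (_ : \sum_i _ = dotp (Q *m v) v); last first.
  by rewrite dotp_sum_entries; do 2 apply: eq_bigr => ? _; rewrite mxE; ring.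
apply => u; rewrite dotp_sum_entries.
rewrite (_ : \sum_i _ = dotp v u ^+ 2) ?sqr_ge0//.
rewrite expr2 /dotp big_distrlr /=.
by do 2 apply: eq_bigr => ? _; rewrite mxE; ring.
Qed.

End HalfLineIntegrals.

(** * The covariance operators Q(t,s) *)

Section EvolutionIntegrals.
Context {R : realType} {n : nat}.
Local Notation leb := (@lebesgue_measure R).
Variables (A B : R -> 'M[R]_n) (f : R -> 'cV[R]_n).
Hypotheses (B_cont : continuous B) (f_cont : continuous f).
Hypothesis A_bnd : exists K : R, forall t, opnorm (A t) <= K.
Hypothesis B_bnd : exists K : R, forall t, opnorm (B t) <= K.
Hypothesis f_bnd : exists K : R, forall t, enorm (f t) <= K.
Variable U : R -> R -> 'M[R]_n.
Hypothesis U_init : forall s, U s s = 1%:M.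
Hypothesis U_ode : forall s t : R,
  is_derive t (1 : R) (fun tau => U tau s) (A t *m U t s).
Variables (w Mc : R).
Hypothesis w_lt0 : w < 0.
Hypothesis U_decay : forall s t, s <= t -> opnorm (U t s) <= Mc * expR (w * (t - s)).

Let F t r := U t r *m B r *m (B r)^T *m (U t r)^T.

Let cocycle := evol_cocycle A_bnd U_init U_ode.

Lemma continuous_mulmx_entry m p q (M : R -> 'M[R]_(m, p)) (N : R -> 'M[R]_(p, q)) :
  (forall i j, continuous (fun r => M r i j)) ->
  (forall i j, continuous (fun r => N r i j)) ->
  forall i j, continuous (fun r => (M r *m N r) i j).
Proof.
move=> cM cN i j; under eq_fun do rewrite mxE.
by apply: continuous_sum_fun => k r; apply: cvgM; [exact: cM|exact: cN].
Qed.

Let cU t i j : continuous (fun r => U t r i j).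
Proof. exact: (continuous_evol_entry_r A_bnd U_init U_ode). Qed.

Let cB i j : continuous (fun r => B r i j).
Proof.
move=> r; apply: (@continuous_comp _ _ _ B (fun M : 'M[R]_n => M i j)).
  exact: B_cont.
exact: coord_continuous.
Qed.

Let cF t i j : continuous (fun r => F t r i j).
Proof.
apply: (@continuous_mulmx_entry _ _ _ (fun r => U t r *m B r *m (B r)^T) (fun r => (U t r)^T)).
  apply: (@continuous_mulmx_entry _ _ _ (fun r => U t r *m B r) (fun r => (B r)^T)).
    by apply: continuous_mulmx_entry.
  by move=> k l; under eq_fun do rewrite mxE; exact: cB.
by move=> k l; under eq_fun do rewrite mxE; exact: cU.
Qed.

Let F_form t r u v :
  dotp (F t r *m u) v = dotp ((B r)^T *m ((U t r)^T *m u)) ((B r)^T *m ((U t r)^T *m v)).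
Proof. by rewrite /F -!mulmxA dotp_tr dotp_tr. Qed.

Let F_sym t r : (F t r)^T = F t r.
Proof. by rewrite /F !trmx_mul !trmxK !mulmxA. Qed.

Let F_gram t r : F t r = (U t r *m B r) *m (U t r *m B r)^T.
Proof. by rewrite /F trmx_mul !mulmxA. Qed.

Let F_shift t u r : F t r = U t u *m F u r *m (U t u)^T.
Proof. by rewrite /F -(cocycle t u r) trmx_mul !mulmxA. Qed.

Let BU_le (K : R) (v : 'cV[R]_n) r x : (forall t, opnorm (B t) <= K) -> r <= x ->
  enorm ((B r)^T *m ((U x r)^T *m v)) <= K * (Mc * expR (w * (x - r)) * enorm v).
Proof.
move=> BK rx; apply: (le_trans (enorm_trmulmx_le _ _)).
have K0 : 0 <= K := le_trans (opnorm_ge0 _) (BK 0).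
apply: ler_pM => //; [exact: opnorm_ge0|exact: enorm_ge0|].
apply: (le_trans (enorm_trmulmx_le _ _)).
by rewrite ler_wpM2r ?enorm_ge0// U_decay.
Qed.

Let sqr_decay x r (c : R) : (c * expR (w * (x - r))) ^+ 2 =
  c ^+ 2 * expR (- (2 * w) * (r - x)).
Proof.
rewrite exprMn -expRM_natl; congr (_ * expR _); ring.
Qed.

Let dotp_delta_r (v : 'cV[R]_n) i : dotp v (delta_mx i 0) = v i 0.
Proof.
rewrite /dotp (bigD1 i)//= big1 ?addr0 ?mxE ?eqxx ?mulr1//.
by move=> j jn; rewrite !mxE (negbTE jn) mulr0.
Qed.

(** The decay bound compares [r] with a later time, so [F u] comes first, dominated by an
    exponential of rate [- (2 * w)]. The constant congruence by [U t u] then reaches every [t], even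
    one before [u]. *)
Let F_int t u i j : leb.-integrable `]-oo, u] (EFin \o (fun r => F t r i j)).
Proof.
have base k l : leb.-integrable `]-oo, u] (EFin \o (fun r => F u r k l)).
  have [K BK] := B_bnd.
  apply: (@integrable_expR_bound _ _ ((K * Mc) ^+ 2) (- (2 * w))).
  - by have := w_lt0; lra.
  - exact: cF.
  - move=> r ru; rewrite -sqr_decay.
    have -> : F u r k l = dotp (F u r *m delta_mx l 0) (delta_mx k 0).
      by rewrite dotp_delta_r -colE [RHS]mxE.
    rewrite F_form; apply: (le_trans (normr_dotp_le _ _)); rewrite expr2.
    have := BU_le (delta_mx l 0) BK ru; have := BU_le (delta_mx k 0) BK ru.
    rewrite !enorm_delta !mulr1 ![K * (Mc * _)]mulrA => h1 h2.
    by apply: ler_pM => //; exact: enorm_ge0.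
have [h _] := @mint_conj R n `]-oo, u]%classic (measurable_itv _) (F u) (U t u) base.
rewrite (_ : (fun r => F t r i j) = (fun r => (U t u *m F u r *m (U t u)^T) i j)).
  exact: h.
by apply/funext => r; rewrite -F_shift.
Qed.

Let f_int t u i : leb.-integrable `]-oo, u] (EFin \o (fun r => (U t r *m f r) i 0)).
Proof.
have base k : leb.-integrable `]-oo, u] (EFin \o (fun r => (U u r *m f r) k 0)).
  have [K fK] := f_bnd.
  apply: (@integrable_expR_bound _ _ (Mc * K) (- w)).
  - by have := w_lt0; lra.
  - apply: continuous_mulmx_entry => //.
    move=> p q r; apply: (@continuous_comp _ _ _ f (fun M : 'cV[R]_n => M p q)).
      exact: f_cont.
    exact: coord_continuous.
  - move=> r ru; rewrite -dotp_delta_r; apply: (le_trans (normr_dotp_le _ _)).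
    rewrite enorm_delta mulr1; apply: (le_trans (enorm_mulmx_le _ _)).
    rewrite mulrAC (_ : - w * (r - u) = w * (u - r)); last by ring.
    by apply: ler_pM; rewrite ?opnorm_ge0 ?enorm_ge0 ?U_decay.
have E r : (U t r *m f r) i 0 = \sum_k U t u i k * (U u r *m f r) k 0.
  by rewrite -(cocycle t u r) -mulmxA mxE.
rewrite (_ : (fun r => (U t r *m f r) i 0) =
  (fun r => \sum_k U t u i k * (U u r *m f r) k 0)); last by apply/funext => r; exact: E.
apply: (Rintegral_sum_seq _ _ _).1 => // k.
rewrite (_ : EFin \o _ = (fun r => (U t u i k)%:E * ((U u r *m f r) k 0)%:E)%E)//.
by apply: integrableZl => //; exact: base.
Qed.

(** The left-hand side has the same integrand as [Qinf U B t], over another half-line. The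
    splitting, the positivity and the differential inequality all rest on this. *)
Lemma evol_Qinf_shift t s :
  U t s *m Qinf U B s *m (U t s)^T = mint `]-oo, s] (F t).
Proof.
have [_ <-] := @mint_conj R n `]-oo, s]%classic (measurable_itv _) (F s) (U t s) (F_int s s).
by congr mint; apply/funext => r; rewrite -F_shift.
Qed.

Let split_int (h : R -> R) s t : s <= t -> leb.-integrable `]-oo, t] (EFin \o h) ->
  \int[leb]_(r in `]-oo, t]) h r = \int[leb]_(r in `]-oo, s]) h r + \int[leb]_(r in `[s, t]) h r.
Proof.
move=> st ih; have := Rintegral_itvB ih (x := s).
rewrite -Rintegral_itv_obnd_cbnd; last first.
  apply: integrableS ih => //.
  by move=> r /=; rewrite !in_itv /= => /andP[].
by move=> <-//; ring.
Qed.

Lemma evol_Qinf_split t s : s <= t ->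
  Qinf U B t = U t s *m Qinf U B s *m (U t s)^T + Qmat U B t s.
Proof.
move=> st; rewrite evol_Qinf_shift; apply/matrixP => i j; rewrite !mxE.
by apply: split_int => //; exact: F_int.
Qed.

Lemma evol_ginf_split t s : s <= t -> ginf U f t = U t s *m ginf U f s + gvec U f t s.
Proof.
move=> st; apply/matrixP => i j; rewrite ord1 [RHS]mxE [LHS]mxE [X in _ = _ + X]mxE.
rewrite (split_int st (f_int t t i)); congr (_ + _); rewrite mxE.
have E r : (U t r *m f r) i 0 = \sum_k U t s i k * (U s r *m f r) k 0.
  by rewrite -(cocycle t s r) -mulmxA mxE.
under eq_Rintegral do rewrite E.
have i0 k : leb.-integrable `]-oo, s] (EFin \o (fun r => U t s i k * (U s r *m f r) k 0)).
  rewrite (_ : EFin \o _ = (fun r => (U t s i k)%:E * ((U s r *m f r) k 0)%:E)%E)//.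
  by apply: integrableZl => //; exact: f_int.
have [_ ->] := Rintegral_sum_seq (measurable_itv _) (index_enum _) i0.
by apply: eq_bigr => k _; rewrite RintegralZl// ?mxE//; exact: f_int.
Qed.

Lemma evol_Qinf_sym t : (Qinf U B t)^T = Qinf U B t.
Proof. by apply: trmx_mint => r; exact: F_sym. Qed.

Lemma evol_Qmat_sym t s : (Qmat U B t s)^T = Qmat U B t s.
Proof. by apply: trmx_mint => r; exact: F_sym. Qed.

Lemma evol_Qinf_psd t : dual_psd (Qinf U B t).
Proof.
apply: (@dual_psd_mint _ _ _ (measurable_itv _) (F t) (fun r => U t r *m B r)).
  by move=> i j; exact: F_int.
by move=> r; exact: F_gram.
Qed.

Lemma evol_Qmat_psd t s : dual_psd (Qmat U B t s).
Proof.
apply: (@dual_psd_mint _ _ _ (measurable_itv _) (F t) (fun r => U t r *m B r)).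
  move=> i j; apply: integrableS (F_int t t i j) => //.
  by move=> r /=; rewrite !in_itv /= => /andP[].
by move=> r; exact: F_gram.
Qed.

Lemma evol_Qinf_shift_psd t s : dual_psd (U t s *m Qinf U B s *m (U t s)^T).
Proof.
rewrite evol_Qinf_shift.
apply: (@dual_psd_mint _ _ _ (measurable_itv _) (F t) (fun r => U t r *m B r)).
  by move=> i j; exact: F_int.
by move=> r; exact: F_gram.
Qed.

Variables (mu0 C : R).
Hypotheses (mu0_gt0 : 0 < mu0) (C_gt0 : 0 < C) (Mc_gt0 : 0 < Mc).
Hypothesis B_low : forall t (x : 'cV[R]_n), mu0 * enorm x <= enorm (B t *m x).
Hypothesis B_up : forall t, opnorm (B t) <= C.

(** Only the end [x] of the half-line moves, so the derivative is the integrand alone and [U] is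
    never differentiated in its second variable. *)
Let q t xi x := \int[leb]_(r in `]-oo, x]) dotp (F t r *m xi) xi.

Let q_derive t xi x : is_derive x (1 : R) (q t xi) (dotp (F t x *m xi) xi).
Proof.
have i1 u := (dotp_mint (measurable_itv _) xi xi (F_int t u)).1.
have [|||d e] := @continuous_FTC1 R (fun r => dotp (F t r *m xi) xi) -oo%O x (x + 1) _ (i1 _).
- by rewrite ltrDl.
- exact: ltNyr.
- suff cc : continuous (fun r => dotp (F t r *m xi) xi) by exact: cc.
  under eq_fun do rewrite dotp_sum_entries.
  apply: continuous_sum_fun => i; apply: continuous_sum_fun => j y.
  by do 2 apply: cvgMr_tmp; exact: cF.
by apply: DeriveDef => //; rewrite -derive1E.
Qed.

(** Factor [U t r = U t x *m U x r]: the decay from [r] to [x] bounds the integrand by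
    [(C Mc N)^2 exp (2 w (x - r))], and the exponential integrates to [1 / (- 2 w)]. *)
Let q_le t xi x :
  q t xi x <= (C * Mc) ^+ 2 / (- (2 * w)) * enorm ((U t x)^T *m xi) ^+ 2.
Proof.
set N := enorm _.
have w2 : 0 < - (2 * w) by have := w_lt0; lra.
have -> : (C * Mc) ^+ 2 / (- (2 * w)) * N ^+ 2 =
    \int[leb]_(r in `]-oo, x]) ((C * Mc * N) ^+ 2 * expR (- (2 * w) * (r - x))).
  rewrite RintegralZl//; last exact: integrable_expR_halfline.
  by rewrite /Rintegral integral_expR_halfline//= !exprMn; ring.
apply: le_Rintegral => //.
- exact: (dotp_mint (measurable_itv _) xi xi (F_int t x)).1.
- rewrite (_ : EFin \o _ = (fun r => ((C * Mc * N) ^+ 2)%:E *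
    (expR (- (2 * w) * (r - x)))%:E)%E)//.
  by apply: integrableZl => //; exact: integrable_expR_halfline.
move=> r; rewrite /= in_itv /= => rx.
rewrite -sqr_decay F_form -sqr_enorm lerXn2r ?nnegrE ?enorm_ge0//.
  by rewrite !mulr_ge0 ?expR_ge0 ?enorm_ge0// ltW.
rewrite -(cocycle t x r) trmx_mul -mulmxA.
apply: (le_trans (BU_le _ B_up rx)).
by rewrite -/N le_eqVlt; apply/orP; left; apply/eqP; ring.
Qed.

(* With [q x] the quadratic form of the left-hand side at time [x], the lower
   bound on [B] and the decay of [U] give [q' >= - 2 c q]; then Gronwall. *)
Lemma evol_Qinf_decay t s xi : s <= t ->
  dotp (U t s *m Qinf U B s *m (U t s)^T *m xi) xi <=
  expR (2 * (w * mu0 ^+ 2 / (Mc ^+ 2 * C ^+ 2) * (t - s))) * dotp (Qinf U B t *m xi) xi.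
Proof.
move=> st; rewrite evol_Qinf_shift.
rewrite (dotp_mint (measurable_itv _) xi xi (F_int t s)).2.
rewrite (dotp_mint (measurable_itv _) xi xi (F_int t t)).2 -/(q t xi s) -/(q t xi t).
set c := w * _ / _.
have := @gronwall_ndecr R (q t xi) (fun x => dotp (F t x *m xi) xi) (- (2 * c)) s t st.
move=> /(_ (fun x _ => q_derive t xi x)) H.
have {H} : expR (- (2 * c) * (t - s)) * q t xi s <= q t xi t.
  apply: H => x _.
  have c0 : 0 <= - (2 * c).
    have p0 : 0 <= mu0 ^+ 2 / (Mc ^+ 2 * C ^+ 2) by apply: divr_ge0; [|apply: mulr_ge0]; exact: sqr_ge0.
    by have := ler_wpM2r p0 (ltW w_lt0); rewrite mul0r mulrA -/c; lra.
  apply: (le_trans (ler_wpM2l c0 (q_le t xi x))).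
  have -> : - (2 * c) * ((C * Mc) ^+ 2 / (- (2 * w)) * enorm ((U t x)^T *m xi) ^+ 2) =
      (mu0 * enorm ((U t x)^T *m xi)) ^+ 2.
    rewrite /c; field.
    by rewrite (lt_eqF w_lt0) (gt_eqF C_gt0) (gt_eqF Mc_gt0).
  rewrite F_form -sqr_enorm lerXn2r ?nnegrE ?mulr_ge0 ?enorm_ge0 ?(ltW mu0_gt0)//.
  exact: enorm_lower_tr.
move=> /(ler_wpM2l (expR_ge0 (2 * (c * (t - s))))); rewrite [leLHS]mulrA -expRD.
by rewrite (_ : 2 * _ + _ = 0) ?expR0 ?mul1r//; ring.
Qed.

End EvolutionIntegrals.

(** * The contraction estimate *)

(** If [a > 0], taking logarithms shows that [ln (a / b) / (2 * d)] is a lower bound of [E], so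
    [inf E] is a genuine infimum above it. If [a <= 0] the claim holds whatever value [inf E]
    takes. *)
Lemma le_expR_inf {R : realType} (E : set R) (a b d : R) : 0 < d -> 0 <= b ->
  E !=set0 -> (forall c, E c -> a <= expR (2 * (c * d)) * b) ->
  a <= expR (2 * (inf E * d)) * b.
Proof.
move=> d0 b0 E0 h; have [a0|a0] := leP a 0.
  by apply: (le_trans a0); rewrite mulr_ge0 ?expR_ge0.
have bp : 0 < b.
  rewrite lt_neqAle b0 andbT eq_sym; apply/eqP => bE.
  by have [c /h] := E0; rewrite bE mulr0 leNgt a0.
have ab : a / b \is Num.pos by rewrite posrE divr_gt0.
suff : ln (a / b) / (2 * d) <= inf E.
  rewrite ler_pdivrMr; last by rewrite mulr_gt0.
  rewrite (_ : inf E * (2 * d) = 2 * (inf E * d)); last by ring.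
  by move=> hl; rewrite -ler_pdivrMr// -[a / b]lnK// ler_expR.
apply: lb_le_inf => // c /h; rewrite -ler_pdivrMr// => hc.
rewrite ler_pdivrMr; last by rewrite mulr_gt0.
rewrite (_ : c * (2 * d) = 2 * (c * d)); last by ring.
by rewrite -ler_expR lnK.
Qed.

Theorem theorem2p17 (R : realType) (n : nat) (n_ge1 : (1 <= n)%N)
  (A B : R -> 'M[R]_n) (f : R -> 'cV[R]_n)
  (A_cont : continuous A) (B_cont : continuous B) (f_cont : continuous f)
  (A_bnd : exists K : R, forall t, opnorm (A t) <= K)
  (B_bnd : exists K : R, forall t, opnorm (B t) <= K)
  (f_bnd : exists K : R, forall t, enorm (f t) <= K)
  (mu0 : R) (mu0_gt0 : 0 < mu0)
  (B_low : forall t (x : 'cV[R]_n), mu0 * enorm x <= enorm (B t *m x))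
  (U : R -> R -> 'M[R]_n)
  (U_init : forall s, U s s = 1%:M)
  (U_ode : forall s t : R, is_derive t (1 : R) (fun tau => U tau s) (A t *m U t s))
  (omega0_neg : growth_bound U < 0)
  (Mw : R -> R)
  (Mw_bound : forall w, growth_bound U < w < 0 ->
     forall s t, s <= t -> opnorm (U t s) <= Mw w * expR (w * (t - s)))
  (N : 'cV[R]_n -> 'M[R]_n -> probability (n.-tuple R) R)
  (N_gauss : forall a Q, covariance_matrix Q -> is_gaussian (N a Q) a Q)
  (s t : R) (st : s < t)
  (phi : n.-tuple R -> R) (phi_meas : measurable_fun setT phi)
  (phi_L2 : ('N[nu N U B f t]_2%:E[EFin \o phi] < +oo)%E) :
  ('N[nu N U B f s]_2%:E[EFin \o Pst N U B f s t
        (fun y => (phi y - Mt N U B f t phi)%R)]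
    <= (expR (c0 U B mu0 Mw * (t - s)))%:E * 'N[nu N U B f t]_2%:E[EFin \o phi])%E.
Proof.
(* At equal times the evolution is the identity, whose norm is at least 1 in positive dimension; so
   the denominators in [c0] do not vanish. *)
have Mw_ge1 w : growth_bound U < w < 0 -> 1 <= Mw w.
  move=> /Mw_bound/(_ s s (lexx s)); rewrite U_init subrr mulr0 expR0 mulr1.
  exact: le_trans (opnorm1 n_ge1).
set C := sup (range (fun t => opnorm (B t))).
have B_up r : opnorm (B r) <= C.
  apply: ub_le_sup; last by exists r.
  by have [K BK] := B_bnd; exists K => _ [x _ <-].
have C_gt0 : 0 < C.
  apply: (lt_le_trans mu0_gt0); apply: le_trans (B_up 0).
  pose e : 'cV[R]_n := delta_mx (Ordinal n_ge1) 0.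
  have := le_trans (B_low 0 e) (enorm_mulmx_le (B 0) e).
  by rewrite enorm_delta !mulr1.
(* One admissible rate is enough for integrability, positivity and the splitting identities; all
   rates together enter only in [hrho], through the infimum. *)
pose w0 := growth_bound U / 2.
have w0I : growth_bound U < w0 < 0 by rewrite /w0; apply/andP; split; have := omega0_neg; lra.
have w0_lt0 : w0 < 0 by case/andP: w0I.
have dec0 := Mw_bound w0 w0I.
have Qtpsd r := evol_Qinf_psd B_cont A_bnd B_bnd U_init U_ode w0_lt0 dec0 r.
have Qpsd := evol_Qmat_psd B_cont A_bnd B_bnd U_init U_ode w0_lt0 dec0 t s.
have Spsd := evol_Qinf_shift_psd B_cont A_bnd B_bnd U_init U_ode w0_lt0 dec0 t s.
have cov r : covariance_matrix (Qinf U B r).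
  by apply: dual_psd_covariance => //; exact: evol_Qinf_sym.
have covQ : covariance_matrix (Qmat U B t s).
  by apply: dual_psd_covariance => //; exact: evol_Qmat_sym.
have Qsplit := evol_Qinf_split B_cont A_bnd B_bnd U_init U_ode w0_lt0 dec0 (ltW st).
have gsplit := evol_ginf_split f_cont A_bnd f_bnd U_init U_ode w0_lt0 dec0 (ltW st).
pose c := c0 U B mu0 Mw; pose rho := expR (2 * (c * (t - s))).
have hrho v : dotp (U t s *m Qinf U B s *m (U t s)^T *m v) v <=
    rho * dotp (Qinf U B t *m v) v.
  apply: le_expR_inf; first by rewrite subr_gt0.
  - exact: (cov t).2.
  - by exists (w0 * mu0 ^+ 2 / (Mw w0 ^+ 2 * C ^+ 2)), w0 => //=; rewrite in_itv.
  - move=> _ [w /= wI <-]; rewrite in_itv /= in wI; have /andP[_ w_lt0] := wI.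
    apply: (evol_Qinf_decay B_cont A_bnd B_bnd U_init U_ode w_lt0 (Mw_bound w wI)
      mu0_gt0 C_gt0 _ B_low B_up v (ltW st)).
    exact: lt_le_trans ltr01 (Mw_ge1 w wI).
have rho0 : 0 <= rho by exact: expR_ge0.
have nsG : is_gaussian (nu N U B f s) (ginf U f s) (Qinf U B s) by exact: N_gauss.
have ntG : is_gaussian (nu N U B f t) (ginf U f t) (Qinf U B t) by exact: N_gauss.
pose K (x : n.-tuple R) := N (U t s *m col_of x + gvec U f t s) (Qmat U B t s).
have KG x : is_gaussian (K x) (U t s *m col_of x + gvec U f t s) (Qmat U B t s).
  exact: N_gauss.
have kP := @bmeas_kernel R n (nu N U B f s) (nu N U B f t) K _ _ _ _ _ _ _
  nsG ntG KG gsplit Qsplit.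
have cP := @centred_contraction R n (nu N U B f s) (nu N U B f t) K _ _ _ _ _ _ _ rho
  nsG ntG KG gsplit Qsplit (cov s).1 (cov t).1 Spsd Qpsd rho0 hrho.
apply: Lnorm2_le.
exact: (L2_kernel_contraction rho0 kP cP phi_meas (Lnorm2_lty phi_L2)).
Qed.
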